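(* Let $(b_t, t \in [0,1])$ be standard planar Brownian motion, and let $d_1 := \sup_{x,y \in b[0,1]} \|x-y\|$ be the diameter of its trace $b[0,1] = \{b_t : t \in [0,1]\}$. Then $\mathbb{E}\, d_1 \leq \sqrt{8 \log 2} \approx 2.3548$.
   Context: Standard planar Brownian motion is the $\mathbb{R}^2$-valued process, started at the origin, whose two coordinates are independent standard one-dimensional Brownian motions. $\|\cdot\|$ is the Euclidean norm on $\mathbb{R}^2$, and $\log$ is the natural logarithm. The symbol $\approx$ indicates the rounded numerical value of $\sqrt{8\log 2}$. *)

(* Defs.v *)
From HB Require Import structures.
From mathcomp Require Import all_boot all_order all_algebra.
From mathcomp Require Import all_classical all_reals all_analysis.

Set Implicit Arguments.
Unset Strict Implicit.
Unset Printing Implicit Defensive.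

Import Order.TTheory GRing.Theory Num.Theory.
Import numFieldNormedType.Exports.

Local Open Scope classical_set_scope.
Local Open Scope ring_scope.

Section brownian_motion.
Context (d : measure_display) (T : measurableType d) (R : realType).
Variable P : probability T R.

(* The product rule for proper subfamilies is the case where some of the
   [A i] are [setT]. *)
Definition mutually_independent (n : nat) (Y : 'I_n -> T -> R) : Prop :=
  forall A : 'I_n -> set R, (forall i, measurable (A i)) ->
    P (\bigcap_i (Y i @^-1` A i)) = (\prod_(i < n) P (Y i @^-1` A i))%E.

(* A process [X] with time set [0, 1] is encoded as a function on all of [R];
   its values at times outside [0, 1] are never constrained nor used. *)
Definition independent_increments (X : R -> T -> R) : Prop :=
  forall (n : nat) (t : nat -> R),
    0 <= t 0%N -> (forall i, (i < n)%N -> t i <= t i.+1) -> t n <= 1 ->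
    mutually_independent (fun (i : 'I_n) w => X (t i.+1) w - X (t i) w).

(* The second argument of [normal_prob] is the standard deviation. *)
Record brownian_motion (X : R -> T -> R) : Prop := BrownianMotion {
  bm_measurable : forall t : R, 0 <= t <= 1 -> measurable_fun [set: T] (X t);
  bm_start : {ae P, forall w, X 0 w = 0};
  bm_independent_increments : independent_increments X;
  bm_normal_increments : forall s t : R, 0 <= s -> s < t -> t <= 1 ->
    forall A : set R, measurable A ->
      P ((fun w => X t w - X s w) @^-1` A) =
      normal_prob 0 (Num.sqrt (t - s)) A;
  bm_continuous :
    {ae P, forall w, {within `[0, 1]%classic, continuous (fun t => X t w)}}
}.

Definition process_sigma_algebra (X : R -> T -> R) : set (set T) :=
  <<s \bigcup_(t in `[0, 1]%classic)
        preimage_set_system [set: T] (X t) (@measurable _ R) >>.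

Definition independent_processes (X Y : R -> T -> R) : Prop :=
  forall A B : set T, process_sigma_algebra X A -> process_sigma_algebra Y B ->
    P (A `&` B) = (P A * P B)%E.

Record planar_brownian_motion (b : R -> T -> R * R) : Prop :=
  PlanarBrownianMotion {
  planar_bm_fst : brownian_motion (fun t w => (b t w).1);
  planar_bm_snd : brownian_motion (fun t w => (b t w).2);
  planar_bm_independent :
    independent_processes (fun t w => (b t w).1) (fun t w => (b t w).2)
}.

Definition trace01 (b : R -> T -> R * R) (w : T) : set (R * R) :=
  [set b t w | t in `[0, 1]%classic].

End brownian_motion.

(* The library norm on [R * R] is the sup norm, hence this definition. *)
Definition euclidean_norm (R : realType) (v : R * R) : R :=
  Num.sqrt (v.1 ^+ 2 + v.2 ^+ 2).

(* Valued in [\bar R], so that unbounded sets get diameter [+oo]. *)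
Definition euclidean_diameter (R : realType) (S : set (R * R)) : \bar R :=
  ereal_sup [set (euclidean_norm (x - y))%:E | x in S & y in S].

(* Main.v *)
(* The squared diameter of the path is at most r1^2 + r2^2, where r1 and r2 are
   the ranges of the two coordinates, and d <= d^2 / (2 s) + s / 2 with
   s = sqrt (8 ln 2). By Fatou along the grids {i / n} it thus suffices that
   E r^2 <= 4 ln 2 for the range r of one Brownian motion sampled on a grid.

   Fix c >= 0 and let q(z) = |z| - dist(z, 2 c Z), an even function which
   increases with |z|. For a continuous path the reflection principle gives
   E max(0, r - c) = 2 E q(X_1). On a grid only the inequality "<=" survives,
   and it is proved without hitting times: given the maximum M and the minimum
   m so far, take as potential q(y - M) + q(y - m) + c if M - m < c, and
   |y - M| + |y - m| otherwise, with y = X_1 the final position. At the last step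
   the potential dominates max(r, c). When a step carries the path to a new
   extremum x, the law of y becomes centered at x, and moving M (or m) to x
   decreases the expected potential, since for Gaussian z and Q even and
   increasing in |z|, the expectation of Q(z + a) is increasing in |a|.

   Finally q is at most 2 sum_{j <= 2n} (-1)^j max(0, |z| - (j + 1) c), and
   integrating over c in [0, oo[ turns max(0, |z| - j c) into z^2 / (2 j), whence
   the partial sums of the alternating harmonic series and ln 2. *)
Require Import Defs.
From HB Require Import structures.
From mathcomp Require Import all_boot all_order all_algebra.
From mathcomp Require Import all_classical all_reals all_analysis.
From mathcomp Require Import measurable_realfun ring lra.

Set Implicit Arguments.
Unset Strict Implicit.
Unset Printing Implicit Defensive.

Import Order.TTheory GRing.Theory Num.Theory.
Import numFieldNormedType.Exports.

Local Open Scope classical_set_scope.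
Local Open Scope ring_scope.

(** * The truncated folding function *)

(* An upper bound of [`|z| - dist(z, 2 c Z)], to which it is equal for
   [`|z| <= (2 * n + 2) * c]. *)
Definition fold_fun {R : realType} (n : nat) (c z : R) : R :=
  2 * \sum_(j < n.*2.+1) (-1) ^+ j * Num.max 0 (`|z| - j.+1%:R * c).

Section fold.
Context {R : realType}.
Implicit Types (n : nat) (c z a b : R).

Lemma max0P (x : R) : 0 <= x /\ Num.max 0 x = x \/ x <= 0 /\ Num.max 0 x = 0.
Proof.
by have [x0|/ltW x0] := leP 0 x; [left|right]; rewrite ?max_r ?max_l.
Qed.

Lemma fold_funS n c z : fold_fun n.+1 c z = fold_fun n c z
  - 2 * Num.max 0 (`|z| - n.*2.+2%:R * c) + 2 * Num.max 0 (`|z| - n.*2.+3%:R * c).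
Proof.
rewrite /fold_fun doubleS 2!big_ord_recr /=.
have e : (-1) ^+ n.*2 = 1 :> R by rewrite -mul2n exprM sqrrN expr1n expr1n.
rewrite !exprS e; set s := \sum_(i < _) _; ring.
Qed.

Lemma fold_fun_mono n c a b : 0 <= c -> `|a| <= `|b| -> fold_fun n c a <= fold_fun n c b.
Proof.
move=> c0 ab; pose t (k : nat) (x : R) : R := 2 * Num.max 0 (`|x| - k%:R * c).
have tmono k : t k a <= t k b.
  rewrite /t; case: (max0P (`|a| - k%:R * c)) => -[? ->];
    by case: (max0P (`|b| - k%:R * c)) => -[? ->]; lra.
(* The induction also compares the increment of [fold_fun] with that of its last term. Increments of
   [t k] decrease in [k], so subtracting the term of index [2 n + 2] costs at most what the term of
   index [2 n + 1] gained. *)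
suff [h _] : 0 <= fold_fun n c b - fold_fun n c a /\
    t n.*2.+1 b - t n.*2.+1 a <= fold_fun n c b - fold_fun n c a by lra.
elim: n => [|n [IH1 IH2]].
  rewrite /fold_fun !big_ord_recl !big_ord0 /= /t; have := tmono 1%N; rewrite /t.
  by move=> ?; split; lra.
have t2 : t n.*2.+2 b - t n.*2.+2 a <= t n.*2.+1 b - t n.*2.+1 a.
  have : n.*2.+1%:R * c <= n.*2.+2%:R * c by rewrite ler_wpM2r ?ler_nat.
  move=> ?; rewrite /t; case: (max0P (`|a| - n.*2.+1%:R * c)) => -[? ->];
    case: (max0P (`|b| - n.*2.+1%:R * c)) => -[? ->];
    case: (max0P (`|a| - n.*2.+2%:R * c)) => -[? ->];
    by case: (max0P (`|b| - n.*2.+2%:R * c)) => -[? ->]; lra.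
have t3 := tmono n.*2.+3.
rewrite doubleS !fold_funS.
move: t2 t3 IH1 IH2; rewrite /t; set u := fold_fun n c b; set v := fold_fun n c a.
move=> *; split; lra.
Qed.

Lemma fold_fun_ge0 n c z : 0 <= c -> 0 <= fold_fun n c z.
Proof.
move=> c0; apply: le_trans (_ : fold_fun n c 0 <= _); last first.
  by apply: fold_fun_mono => //; rewrite normr0.
rewrite /fold_fun big1 ?mulr0// => j _; rewrite normr0.
have : 0 <= j.+1%:R * c by rewrite mulr_ge0.
by move=> ?; rewrite max_l ?mulr0//; lra.
Qed.

(** The terms for [z - c] are those for [z] shifted by one index, hence of opposite sign. All cancel
    but the first and a last one, which is nonnegative because the sum stops after a positive
    term. *)
Lemma fold_fun_tele n c z : 0 <= c -> c <= z ->
  2 * z - 2 * c <= fold_fun n c z + fold_fun n c (z - c).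
Proof.
move=> c0 cz.
suff -> : fold_fun n c z + fold_fun n c (z - c)
    = 2 * z - 2 * c + 2 * Num.max 0 (z - n.*2.+2%:R * c).
  by rewrite lerDl mulr_ge0// le_max lexx.
elim: n => [|n IH].
  rewrite /fold_fun !big_ord_recl !big_ord0 /= !ger0_norm; [|lra|lra].
  rewrite (_ : z - c - 1 * c = z - 2 * c); last by ring.
  by rewrite [Num.max 0 (z - 1 * c)]max_r; lra.
rewrite !fold_funS addrACA [X in X + _]addrACA IH !ger0_norm; [|lra|lra].
rewrite (_ : z - c - n.*2.+2%:R * c = z - n.*2.+3%:R * c); last first.
  by rewrite -[n.*2.+3%:R]natr1; ring.
rewrite (_ : z - c - n.*2.+3%:R * c = z - n.*2.+4%:R * c); last first.
  by rewrite -[n.*2.+4%:R]natr1; ring.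
by rewrite doubleS; lra.
Qed.

Lemma fold_funN n c z : fold_fun n c (- z) = fold_fun n c z.
Proof. by rewrite /fold_fun normrN. Qed.

(** For the exact function [|z| - dist(z, 2 c Z)] this is an equality, since the distances of [z]
    and [z - c] to [2 c Z] add up to [c]. The reflection [z -> c - z] reduces [z < 0] to [c < z]; in
    between the left side is 0. *)
Lemma fold_fun_ge n c z : 0 <= c ->
  `|z| + `|z - c| - c <= fold_fun n c z + fold_fun n c (z - c).
Proof.
move=> c0; have [zc|zc] := leP c z.
  by apply: le_trans (fold_fun_tele n c0 zc); rewrite !ger0_norm; lra.
have [z0|z0] := leP 0 z.
  apply: le_trans (addr_ge0 (fold_fun_ge0 n z c0) (fold_fun_ge0 n (z - c) c0)).
  by rewrite ger0_norm// ltr0_norm; lra.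
have h : c <= c - z by lra.
have := fold_fun_tele n c0 h.
rewrite -[fold_fun n c (z - c)]fold_funN opprB -[fold_fun n c z]fold_funN.
rewrite (_ : c - z - c = - z); last by ring.
by move=> t; rewrite !ltr0_norm; lra.
Qed.

(** Grouping by sign allows the negative terms to change sides, so that only nonnegative functions
    are integrated later. *)
Lemma fold_fun_split n c z :
  fold_fun n c z + \sum_(i < n) 2 * Num.max 0 (`|z| - i.*2.+2%:R * c)
  = \sum_(i < n.+1) 2 * Num.max 0 (`|z| - i.*2.+1%:R * c).
Proof.
elim: n => [|n IH]; first by rewrite big_ord0 addr0 /fold_fun !big_ord_recl !big_ord0 /=; ring.
by rewrite big_ord_recr/= [RHS]big_ord_recr/= -IH fold_funS doubleS; ring.
Qed.

End fold.

(** * Gaussian integrals *)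

Section lebesgue_reflection.
Context {R : realType}.
Local Open Scope ereal_scope.
Notation mu := (@lebesgue_measure R).

Lemma lebesgue_measure_reflection (k : R) (A : set R) : measurable A ->
  pushforward mu ((fun x => k - x)%R : _ -> measurableTypeR R) A = mu A.
Proof.
move=> mA; apply/esym/lebesgue_measure_unique => //=.
  exact: measurable_funB.
move=> ? _ [[a b]] _ <-; rewrite /pushforward.
rewrite (_ : _ @^-1` _ = `[k - b, k - a[%classic)%R; last first.
  by apply/seteqP; split => x; rewrite /= !in_itv/=; lra.
rewrite !lebesgue_measure_itv/= !lte_fin (_ : (k - b < k - a)%R = (a < b)%R); last by lra.
by case: ifP => // _; rewrite -!EFinB; congr _%:E; lra.
Qed.

Lemma ge0_integral_reflection (k : R) (f : R -> \bar R) :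
  measurable_fun [set: R] f -> (forall x, 0 <= f x) ->
  \int[mu]_x f (k - x)%R = \int[mu]_x f x.
Proof.
move=> mf f0.
transitivity (\int[pushforward mu
  ((fun x => k - x)%R : measurableTypeR R -> measurableTypeR R)]_x f x); last first.
  apply: eq_measure_integral => /=; first exact: measurable_funB.
  by move=> ? A mA _; exact: lebesgue_measure_reflection.
rewrite ge0_integral_pushforward//=.
exact: measurable_funB.
Qed.

End lebesgue_reflection.

Section normal_integral.
Context {R : realType}.
Local Open Scope ereal_scope.
Notation mu := (@lebesgue_measure R).

(** The Radon-Nikodym derivative and [normal_pdf] have the same integral over every measurable set,
    hence agree almost everywhere. *)
Lemma ge0_integral_normal_prob (m s : R) (f : R -> \bar R) :
  measurable_fun [set: R] f -> (forall x, 0 <= f x) ->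
  \int[normal_prob m s]_x f x = \int[mu]_x (f x * (normal_pdf m s x)%:E).
Proof.
move=> mf f0.
have dom := normal_prob_dominates m s.
rewrite -(Radon_Nikodym_SigmaFinite.change_of_variables dom)//.
have mpdf : measurable_fun [set: R] (EFin \o normal_pdf m s).
  by apply/measurable_EFinP; exact: measurable_normal_pdf.
have mh := measurable_int _ (Radon_Nikodym_SigmaFinite.f_integrable dom).
apply: ge0_ae_eq_integral => //.
- exact: emeasurable_funM.
- exact: emeasurable_funM.
- by move=> x _; rewrite mule_ge0// Radon_Nikodym_SigmaFinite.f_ge0.
- by move=> x _; rewrite mule_ge0// lee_fin normal_pdf_ge0.
- apply: ae_eqe_mul2l; apply: integral_ae_eq => //.
    exact: Radon_Nikodym_SigmaFinite.f_integrable.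
  by move=> E _ mE; rewrite -Radon_Nikodym_SigmaFinite.f_integral.
Qed.

End normal_integral.

(** * Gaussian expectations under shifts *)

Section anderson.
Context {R : realType}.
Local Open Scope ereal_scope.
Notation mu := (@lebesgue_measure R).

Lemma normal_pdf_even_mono (s x y : R) : s != 0%R -> (`|y| <= `|x|)%R ->
  (normal_pdf 0 s x <= normal_pdf 0 s y)%R.
Proof.
move=> s0 yx; rewrite !normal_pdfE// ler_wpM2l ?normal_peak_ge0// ler_expR !subr0.
rewrite ler_wpM2r ?invr_ge0 ?mulrn_wge0 ?sqr_ge0// lerN2.
by rewrite -(ger0_norm (sqr_ge0 x)) -(ger0_norm (sqr_ge0 y)) !normrX lerXn2r ?nnegrE.
Qed.

Lemma normal_pdfN (s x : R) : s != 0%R -> normal_pdf 0 s (- x) = normal_pdf 0 s x.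
Proof. by move=> s0; rewrite !normal_pdfE// /normal_fun !subr0 sqrrN. Qed.

(* With [p] the density, the change of variables [z -> - (a + b) - z] shows that
   twice the difference of the two sides is the integral of
   [(Q (z + b) - Q (z + a)) * (p z - p (z + (a + b)))], whose factors never
   have opposite signs because [(b - a) * (a + b) >= 0]. *)
Lemma le_integral_normal_prob_shift (s a b : R) (Q : R -> R) :
  s != 0%R -> measurable_fun [set: R] Q -> (forall x, 0 <= Q x)%R ->
  (forall x y, `|x| <= `|y| -> Q x <= Q y)%R -> (`|a| <= `|b|)%R ->
  \int[normal_prob 0 s]_z (Q (z + a))%:E <= \int[normal_prob 0 s]_z (Q (z + b))%:E.
Proof.
move=> s0 mQ Q0 Qm ab.
pose p := normal_pdf 0 s.
have mp : measurable_fun [set: R] p by exact: measurable_normal_pdf.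
have p0 x : (0 <= p x)%R by exact: normal_pdf_ge0.
have mS (f : R -> R) e : measurable_fun [set: R] f -> measurable_fun [set: R] (fun z => f (z + e)%R).
  by move=> mf; apply: measurableT_comp => //; exact: measurable_funD.
have mF u v : measurable_fun [set: R] (fun z => (Q (z + u) * p (z + v))%:E).
  by apply/measurable_EFinP/measurable_funM; exact: mS.
have F0 u v x : 0 <= (Q (x + u) * p (x + v))%:E by rewrite lee_fin mulr_ge0.
have QE e : \int[normal_prob 0 s]_z (Q (z + e))%:E = \int[mu]_z (Q (z + e) * p (z + 0))%:E.
  transitivity (\int[mu]_z ((Q (z + e))%:E * (p z)%:E)); last first.
    by apply: eq_integral => z _; rewrite addr0.
  apply: (@ge0_integral_normal_prob _ _ _ (fun z => (Q (z + e))%:E)).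
    by apply/measurable_EFinP; exact: mS.
  by move=> x; rewrite lee_fin.
have QR u v : \int[mu]_z (Q (z + u) * p (z + 0))%:E = \int[mu]_z (Q (z + v) * p (z + (u + v)))%:E.
  rewrite -(@ge0_integral_reflection _ (- (u + v))
    (fun z => (Q (z + u) * p (z + 0))%:E)); [|exact: mF|exact: F0].
  apply: eq_integral => z _; congr (_ * _)%:E.
    by apply/eqP; rewrite eq_le; apply/andP; split; apply: Qm;
      rewrite (_ : - (u + v) - z + u = - (z + v))%R ?normrN//; ring.
  by rewrite -[RHS]normal_pdfN//; congr normal_pdf; ring.
rewrite !QE.
(* Sums are compared instead of differences, because the integrals may be infinite. *)
suff h : \int[mu]_z (Q (z + a) * p (z + 0))%:E + \int[mu]_z (Q (z + a) * p (z + 0))%:E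
      <= \int[mu]_z (Q (z + b) * p (z + 0))%:E + \int[mu]_z (Q (z + b) * p (z + 0))%:E.
  move: h; set I := integral _ _ _; set J := integral _ _ _.
  by rewrite -!mule2n -!mule_natl lee_pmul2l ?fin_num_natr// lte_fin ltr0n.
rewrite [in X in X + _ <= _](QR a b) [in X in _ <= _ + X](QR b a) (addrC b a).
rewrite -(ge0_integralD mu measurableT (fun x _ => F0 b 0%R x) (mF b 0%R)
  (fun x _ => F0 a (a + b)%R x) (mF a (a + b)%R)).
rewrite -(ge0_integralD mu measurableT (fun x _ => F0 b (a + b)%R x) (mF b (a + b)%R)
  (fun x _ => F0 a 0%R x) (mF a 0%R)).
apply: ge0_le_integral; first exact: measurableT.
- by move=> x _; apply: adde_ge0; exact: F0.
- by apply: emeasurable_funD; exact: mF.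
- by apply: emeasurable_funD; exact: mF.
move=> z _; rewrite -!EFinD lee_fin addr0.
have sq (u v : R) : (0 <= (v - u) * (v + u) -> `|u| <= `|v|)%R.
  move=> uv; rewrite -(ler_pXn2r (_ : 0 < 2)%N) ?nnegrE// -!normrX !ger0_norm ?sqr_ge0//.
  by rewrite -subr_ge0 subr_sqr.
rewrite -subr_ge0.
rewrite (_ : _ - _ = (Q (z + b) - Q (z + a)) * (p z - p (z + (a + b))))%R; last by ring.
(* Both signs follow from [(z + b)^2 - (z + a)^2 = (b - a) (2 z + a + b)] and [(z + a + b)^2 - z^2 =
   (a + b) (2 z + a + b)]. *)
have [b0|b0] := leP 0%R b.
  have [ba sab] : (0 <= b - a /\ 0 <= a + b)%R.
    by move: ab; rewrite (ger0_norm b0) ler_norml; lra.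
  have [zab|zab] := leP 0%R (2 * z + (a + b))%R.
    apply: mulr_ge0; rewrite subr_ge0; [apply/Qm/sq|apply: normal_pdf_even_mono => //; apply/sq].
      by rewrite (_ : _ * _ = (b - a) * (2 * z + (a + b)))%R; [exact: mulr_ge0|ring].
    by rewrite (_ : _ * _ = (a + b) * (2 * z + (a + b)))%R; [exact: mulr_ge0|ring].
  apply: mulr_le0; rewrite subr_le0; [apply/Qm/sq|apply: normal_pdf_even_mono => //; apply/sq].
    by rewrite (_ : _ * _ = (b - a) * - (2 * z + (a + b)))%R; [apply: mulr_ge0 => //; lra|ring].
  by rewrite (_ : _ * _ = (a + b) * - (2 * z + (a + b)))%R; [apply: mulr_ge0 => //; lra|ring].
have [ba sab] : (0 <= a - b /\ 0 <= - (a + b))%R.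
  by move: ab; rewrite (ltr0_norm b0) ler_norml; lra.
have [zab|zab] := leP 0%R (2 * z + (a + b))%R.
  apply: mulr_le0; rewrite subr_le0; [apply/Qm/sq|apply: normal_pdf_even_mono => //; apply/sq].
    by rewrite (_ : _ * _ = (a - b) * (2 * z + (a + b)))%R; [exact: mulr_ge0|ring].
  by rewrite (_ : _ * _ = - (a + b) * (2 * z + (a + b)))%R; [exact: mulr_ge0|ring].
apply: mulr_ge0; rewrite subr_ge0; [apply/Qm/sq|apply: normal_pdf_even_mono => //; apply/sq].
  by rewrite (_ : _ * _ = (a - b) * - (2 * z + (a + b)))%R; [apply: mulr_ge0 => //; lra|ring].
by rewrite (_ : _ * _ = - (a + b) * - (2 * z + (a + b)))%R; [apply: mulr_ge0 => //; lra|ring].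
Qed.
End anderson.

(** * The second moment of the standard normal law *)

Section normal_second_moment.
Context {R : realType}.
Local Open Scope ereal_scope.
Notation mu := (@lebesgue_measure R).
Let p := normal_pdf (0 : R) 1.

Let p_cont : continuous p.
Proof. by apply: continuous_normal_pdf; exact: oner_neq0. Qed.

Let pN x : p (- x) = p x.
Proof.
by rewrite /p !normal_pdfE ?oner_neq0// /normal_fun !subr0 sqrrN.
Qed.

Lemma is_derive_normal_pdf01 (x : R) : is_derive x 1%R p (- x * p x)%R.
Proof.
rewrite /p normal_pdfE ?oner_neq0//.
have fE : (fun x : R => normal_peak 1 * normal_fun 0 1 x)%R =
    (normal_peak (1 : R) \*: (expR \o (fun x => (- 2^-1) *: (x * x))))%R.
  apply/funext => y /=; rewrite /normal_fun subr0 expr1n; congr (_ * expR _)%R.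
  by rewrite /GRing.scale /=; field.
rewrite fE; have h : is_derive x 1%R (fun x : R => (- 2^-1) *: (x * x))%R (- x)%R.
  by apply: is_derive_eq; rewrite /GRing.scale/=; field.
have g := @is_derive1_comp _ expR (fun x : R => (- 2^-1) *: (x * x))%R x _ _ (is_derive_expR _) h.
apply: is_derive_eq.
have /= -> := congr1 (@^~ x) fE; rewrite /GRing.scale/=; ring.
Qed.

(** As [p' x = - x * p x], integrating [(- x) * p' x] by parts over [[0, n + 1]] leaves the integral
    of [p] and a boundary term that is at most 0. Parity and exhaustion by these intervals give the
    whole line. *)
Lemma integral_sqr_normal01_le1 : \int[normal_prob 0 1]_z (z ^+ 2 : R)%:E <= 1.
Proof.
have mp : measurable_fun [set: R] p by exact: measurable_normal_pdf.
have p0 x : (0 <= p x)%R by exact: normal_pdf_ge0.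
have q0 x : (0 <= x ^+ 2 * p x)%R by rewrite mulr_ge0 ?sqr_ge0.
have cq : continuous (fun x : R => x ^+ 2 * p x)%R.
  by move=> x; apply: cvgM; [exact: sqr_continuous|exact: p_cont].
have mq : measurable_fun [set: R] (fun x : R => x ^+ 2 * p x)%R.
  exact: continuous_measurable_fun.
have -> : \int[normal_prob 0 1]_z (z ^+ 2 : R)%:E = \int[mu]_x (x ^+ 2 * p x)%:E.
  apply: (@ge0_integral_normal_prob _ _ _ (fun z => (z ^+ 2)%:E)).
    by apply/measurable_EFinP; exact: measurable_funX.
  by move=> x; rewrite lee_fin sqr_ge0.
rewrite -(integral_normal_pdf (0 : R) 1) -/p.
rewrite !ge0_symfun_integralT//; last 2 first.
  by move=> x /=; rewrite pN.
  by move=> x /=; rewrite pN sqrrN.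
apply: lee_wpmul2l => //.
rewrite -set_itvcy ge0_integral_ereal_sup//; apply: ge_ereal_sup => _ [n _ <-].
apply: (@le_trans _ _ (\int[mu]_(x in `[0%R, n.+1%:R]) (p x)%:E)); last first.
  apply: ge0_subset_integral => //=.
  - by apply/measurable_EFinP; exact: measurable_funS mp.
  - by move=> x _; rewrite lee_fin.
  - exact: subset_itvl.
have dp x : derivable p x 1%R by have [] := is_derive_normal_pdf01 x.
have n0 : (0 < n.+1%:R :> R)%R by rewrite ltr0n.
have pE : \int[mu]_(x in `[0%R, n.+1%:R]) (x ^+ 2 * p x)%:E =
    \int[mu]_(x in `[0%R, n.+1%:R]) ((- x) * (- x * p x))%:E.
  by apply: eq_integral => x _; congr _%:E; ring.
rewrite pE (@integration_by_parts R (fun x => - x)%R p (fun=> -1)%R (fun x => - x * p x)%R 0 n.+1%:R n0).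
- rewrite oppr0 mul0r subr0.
  have -> : \int[mu]_(x in `[0%R, n.+1%:R]) (-1 * p x)%:E = - \int[mu]_(x in `[0%R, n.+1%:R]) (p x)%:E.
    rewrite -integral_ge0N//; last by move=> x _; rewrite lee_fin.
    by apply: eq_integral => x _; rewrite mulN1r EFinN.
  rewrite oppeK -[leRHS]add0e; apply: leeD => //.
  by rewrite lee_fin mulNr oppr_le0 mulr_ge0.
- by apply: continuous_subspaceT => x; exact: cvg_cst.
- split.
  + by move=> x _; exact: derivableN.
  + by apply: cvg_at_right_filter; apply: cvgN; exact: cvg_id.
  + by apply: cvg_at_left_filter; apply: cvgN; exact: cvg_id.
- by move=> x _; rewrite derive1N ?derive1_id.
- apply: continuous_subspaceT => x; apply: cvgM; last exact: p_cont.
  by apply: cvgN; exact: cvg_id.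
- split.
  + by move=> x _; exact: dp.
  + by apply: cvg_at_right_filter; exact: p_cont.
  + by apply: cvg_at_left_filter; exact: p_cont.
- by move=> x _; rewrite derive1E; have [_ ->] := is_derive_normal_pdf01 x.
Qed.
End normal_second_moment.

(** * Independence *)

Section independence.
Context d dS dU (T : measurableType d) (S : measurableType dS) (U : measurableType dU).
Context {R : realType} (P : probability T R) (nu : probability U R).
Local Open Scope ereal_scope.

(** The product rule on rectangles identifies the joint law with the product of the law of [Z] and
    [nu]; Tonelli does the rest. *)
Lemma ge0_integral_indep (Z : {mfun T >-> S}) (Y : {mfun T >-> U}) (f : S * U -> \bar R) :
  (forall A B, measurable A -> measurable B ->
    P (Z @^-1` A `&` Y @^-1` B) = P (Z @^-1` A) * nu B) ->
  measurable_fun [set: S * U] f -> (forall x, 0 <= f x) ->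
  \int[P]_w f (Z w, Y w) = \int[distribution P Z]_s \int[nu]_u f (s, u).
Proof.
move=> ZY mf f0.
have mZY : measurable_fun [set: T] (fun w => (Z w, Y w)).
  by apply: measurable_fun_pair; exact: measurable_funPT.
rewrite -(fubini_tonelli1 f)//.
rewrite (eq_measure_integral (distribution P [the {mfun T >-> (S * U)%type} of
  mfun_Sub (mem_set mZY)])); last first.
  move=> A mA _; apply: product_measure_unique => // B C mB mC; exact: ZY.
by rewrite ge0_integral_pushforward//.
Qed.

(** This plays the part of conditioning: an inequality with the past frozen at [s] and only the
    independent future averaged passes to the full expectation. *)
Lemma le_integral_indep (Z : {mfun T >-> S}) (Y : {mfun T >-> U}) (f g : S * U -> \bar R) :
  (forall A B, measurable A -> measurable B ->
    P (Z @^-1` A `&` Y @^-1` B) = P (Z @^-1` A) * nu B) ->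
  measurable_fun [set: S * U] f -> (forall x, 0 <= f x) ->
  measurable_fun [set: S * U] g -> (forall x, 0 <= g x) ->
  (forall s, \int[nu]_u f (s, u) <= \int[nu]_u g (s, u)) ->
  \int[P]_w f (Z w, Y w) <= \int[P]_w g (Z w, Y w).
Proof.
move=> ZY mf f0 mg g0 fg; rewrite !ge0_integral_indep//.
apply: ge0_le_integral => //.
- by move=> s _; exact: integral_ge0.
- exact: measurable_fun_fubini_tonelli_F.
- exact: measurable_fun_fubini_tonelli_F.
Qed.

End independence.

(** * The range potential *)

Definition range_potential {R : realType} (Q : R -> R) (c M m y : R) : R :=
  if M - m < c then Q (y - M) + Q (y - m) + c else `|y - M| + `|y - m|.

(** This is all that the potential argument asks of the law of the increment still to come. It holds
    for centered normal laws and for the Dirac mass at 0, the law left at time 1. *)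
Definition shift_monotone {R : realType} (nu : probability (measurableTypeR R) R) :=
  forall Q : R -> R, measurable_fun [set: R] Q -> (forall x, 0 <= Q x) ->
    (forall x y, `|x| <= `|y| -> Q x <= Q y) ->
  forall a b : R, `|a| <= `|b| ->
    (\int[nu]_z (Q (z + a))%:E <= \int[nu]_z (Q (z + b))%:E)%E.

Section range_potential.
Context {R : realType} (Q : R -> R) (c : R).
Hypotheses (mQ : measurable_fun [set: R] Q) (Q0 : forall x, 0 <= Q x)
  (Qm : forall x y, `|x| <= `|y| -> Q x <= Q y)
  (Qc : forall z, `|z| + `|z - c| - c <= Q z + Q (z - c)) (c0 : 0 <= c).

Lemma range_potential_ge0 M m y : 0 <= range_potential Q c M m y.
Proof. by rewrite /range_potential; case: ifP => _; rewrite !addr_ge0. Qed.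

Lemma le_range_potential M m y : m <= y <= M ->
  Num.max (M - m) c <= range_potential Q c M m y.
Proof.
move=> /andP[my yM]; rewrite /range_potential; case: ltP => h.
  by rewrite -lerBlDr subrr addr_ge0.
by rewrite (ler0_norm (_ : y - M <= 0)) ?subr_le0// ger0_norm ?subr_ge0//; lra.
Qed.

Lemma measurable_range_potential d (T : measurableType d) (M m y : T -> R) :
  measurable_fun [set: T] M -> measurable_fun [set: T] m -> measurable_fun [set: T] y ->
  measurable_fun [set: T] (fun w => range_potential Q c (M w) (m w) (y w)).
Proof.
move=> mM mm my; rewrite /range_potential; apply: measurable_fun_ifT.
- by apply: measurable_fun_ltr => //; exact: measurable_funB.
- by apply: measurable_funD => //; apply: measurable_funD; apply: measurableT_comp => //;
     exact: measurable_funB.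
- by apply: measurable_funD; apply: measurableT_comp => //; exact: measurable_funB.
Qed.

Context (nu : probability (measurableTypeR R) R).
Hypothesis num : shift_monotone nu.

Let shiftD (F H : R -> R) a b : measurable_fun [set: R] F -> (forall x, 0 <= F x) ->
    (forall x y, `|x| <= `|y| -> F x <= F y) ->
    measurable_fun [set: R] H -> (forall x, 0 <= H x) -> `|a| <= `|b| ->
  (\int[nu]_z (F (z + a) + H z)%:E <= \int[nu]_z (F (z + b) + H z)%:E)%E.
Proof.
move=> mF F0 Fm mH H0 ab.
have mFs e : measurable_fun [set: measurableTypeR R] (fun z => (F (z + e))%:E).
  by apply/measurable_EFinP; apply: measurableT_comp => //; exact: measurable_funD.
have FH e : (\int[nu]_z (F (z + e) + H z)%:E = \int[nu]_z (F (z + e))%:E + \int[nu]_z (H z)%:E)%E.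
  apply: (@ge0_integralD _ _ _ nu setT measurableT (fun z => (F (z + e))%:E) (fun z => (H z)%:E)) => //.
  - by move=> x _; rewrite lee_fin.
  - by move=> x _; rewrite lee_fin.
  - exact/measurable_EFinP.
by rewrite !FH leeD2r// num.
Qed.

Let mQs e : measurable_fun [set: R] (fun z => Q (z + e)).
Proof. by apply: measurableT_comp => //; exact: measurable_funD. Qed.

Let mns e : measurable_fun [set: R] (fun z => `|z + e|).
Proof. by apply: measurableT_comp => //; exact: measurable_funD. Qed.

Let mn : measurable_fun [set: R] (fun z : R => `|z|).
Proof. exact: measurableT_comp. Qed.

Let n0 (x : R) : 0 <= `|x|. Proof. by []. Qed.

Let nm (x y : R) : `|x| <= `|y| -> `|x| <= `|y|. Proof. by []. Qed.

(* One end [e] of the range moves to the new position [x] while the other end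
   [k] stays put. If the length of the range passes [c] on the way, the
   replacement is made in two stages, through the end [e'] at distance [c]. *)
Let move_end (e k x : R) : `|e - k| <= `|x - k| -> `|x - e| <= `|x - k| ->
  `|x - k| = `|e - k| + `|x - e| ->
  (\int[nu]_z ((if `|x - k| < c then Q z + Q (z + (x - k)) + c
               else `|z| + `|z + (x - k)|)%:E) <=
  \int[nu]_z ((if `|e - k| < c then Q (z + (x - e)) + Q (z + (x - k)) + c
               else `|z + (x - e)| + `|z + (x - k)|)%:E))%E.
Proof.
move=> ekx xek xk.
have mH : measurable_fun [set: R] (fun z => Q (z + (x - k)) + c).
  exact: measurable_funD.
have H0 z : 0 <= Q (z + (x - k)) + c by rewrite addr_ge0.
have e0 : `|0 : R| <= `|x - e| by rewrite normr0.
case: (ltP `|x - k| c) => [xc|xc].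
  rewrite (le_lt_trans ekx xc).
  have := shiftD mQ Q0 Qm mH H0 e0.
  by under eq_integral do rewrite addr0 addrA;
     under [X in (_ <= X)%E -> _]eq_integral do rewrite addrA.
case: (ltP `|e - k| c) => [ec|ec]; last first.
  have := shiftD mn n0 nm (mns (x - k)) (fun z => n0 _) e0.
  by under eq_integral do rewrite addr0.
(* The point [e'] lies between [e] and [x], at distance [c] from [k]. *)
pose s : R := if 0 <= x - k then 1 else -1.
pose e' := k + s * c.
have [h1 h2] : `|x - e'| <= `|x - e| /\ (s = 1 \/ s = -1).
  rewrite /e' /s; split; last by case: ifP => _; [left|right].
  move: xc ec xk; case: (leP 0 (x - k)) => xk0.
    rewrite (ger0_norm xk0) mul1r => xc ec xk.
    rewrite [leLHS]ger0_norm; last by lra.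
    by lra.
  rewrite (ltr0_norm xk0) mulN1r => xc ec xk.
  rewrite [leLHS]ler0_norm; last by lra.
  by lra.
(* Read from the right-hand side, the end moves from [e] to [e']; the length is then exactly [c], so
   [Qc] exchanges [Q] for absolute values; last, the end moves from [e'] to [x]. *)
apply: (@le_trans _ _ (\int[nu]_z (Q (z + (x - e')) + (Q (z + (x - k)) + c))%:E)%E).
  have e0' : `|0 : R| <= `|x - e'| by rewrite normr0.
  apply: le_trans (_ : (\int[nu]_z (`|z + (x - e')| + `|z + (x - k)|)%:E <= _)%E).
    have := shiftD mn n0 nm (mns (x - k)) (fun z => n0 _) e0'.
    under eq_integral do rewrite addr0.
    by [].
  apply: ge0_le_integral => //=.
  - by apply/measurable_EFinP; exact: (measurable_funD (mns _) (mns _)).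
  - by apply/measurable_EFinP; exact: (measurable_funD (mQs _) mH).
  move=> z _; rewrite lee_fin.
  have [se|se] := h2.
    have := Qc (z + (x - k)).
    by rewrite (_ : z + (x - k) - c = z + (x - e'))//; [lra|rewrite /e' se; ring].
  have := Qc (z + (x - e')).
  by rewrite (_ : z + (x - e') - c = z + (x - k))//; [lra|rewrite /e' se; ring].
have := shiftD mQ Q0 Qm mH H0 h1.
by under [X in (_ <= X)%E -> _]eq_integral do rewrite addrA.
Qed.

(** A position inside [[m, M]] changes nothing. One outside moves only the nearer end, which is an
    instance of [move_end] with the far end fixed. *)
Lemma le_integral_range_potential (M m x : R) : m <= M ->
  (\int[nu]_z (range_potential Q c (Num.max M x) (Num.min m x) (x + z))%:E <=
   \int[nu]_z (range_potential Q c M m (x + z))%:E)%E.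
Proof.
move=> mM; rewrite /range_potential.
have [xM|Mx] := leP x M; last first.
  rewrite (min_l (le_trans mM (ltW Mx))).
  have := @move_end M m x.
  rewrite (_ : `|M - m| = M - m); last by rewrite ger0_norm ?subr_ge0.
  rewrite (_ : `|x - m| = x - m); last by rewrite ger0_norm//; lra.
  rewrite (_ : `|x - M| = x - M); last by rewrite ger0_norm//; lra.
  have h1 : M - m <= x - m by lra.
  have h2 : x - M <= x - m by lra.
  have h3 : x - m = M - m + (x - M) by lra.
  move=> /(_ h1 h2 h3).
  have zx z : x + z - x = z by ring.
  have zk k z : x + z - k = z + (x - k) by ring.
  by under [in X in _ -> (_ <= X)%E]eq_integral do rewrite !zk;
     under [in X in _ -> (X <= _)%E]eq_integral do rewrite zx zk.
have [mx|xm] := leP m x; first by [].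
have := @move_end m M x.
rewrite (_ : `|m - M| = M - m); last by rewrite distrC ger0_norm ?subr_ge0.
rewrite (_ : `|x - M| = M - x); last by rewrite distrC ger0_norm//; lra.
rewrite (_ : `|x - m| = m - x); last by rewrite distrC ger0_norm//; lra.
have h1 : M - m <= M - x by lra.
have h2 : m - x <= M - x by lra.
have h3 : M - x = M - m + (m - x) by lra.
move=> /(_ h1 h2 h3).
have zx z : x + z - x = z by ring.
have zk k z : x + z - k = z + (x - k) by ring.
under [in X in _ -> (_ <= X)%E]eq_integral do rewrite !zk [Q _ + Q _]addrC [`|_| + `|_|]addrC.
by under [in X in _ -> (X <= _)%E]eq_integral do rewrite zx zk [Q _ + Q _]addrC [`|_| + `|_|]addrC.
Qed.

End range_potential.

(** * Independence of the increments of a Brownian motion *)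

(** For [S] the Borel sets, this is a pi-system generating the sigma-algebra of the first [k]
    variables. *)
Definition cylinders {T R : Type} (S : set (set R)) (k : nat) (Y : nat -> T -> R) : set (set T) :=
  [set A | exists B : nat -> set R,
     (forall i, S (B i)) /\ A = \bigcap_(i < k) (Y i @^-1` B i)].

Section cylinders.
Context d (T : measurableType d) {R : realType} (P : probability T R).
Variables (k : nat) (Y : nat -> T -> R).
Local Notation G := (cylinders measurable k Y).

(** Both sides are finite measures in [A], a restriction and a multiple of [P], and they agree on a
    pi-system containing the whole space. *)
Lemma indep_g_sigma_cylinders (D : set T) : measurable D ->
  (forall i, (i < k)%N -> measurable_fun [set: T] (Y i)) ->
  (forall A, G A -> P (A `&` D) = (P A * P D)%E) ->
  forall A, <<s G >> A -> P (A `&` D) = (P A * P D)%E.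
Proof.
move=> mD mY GD A GA.
have [p pE] : exists p : {nonneg R}, P D = (p%:num)%:E.
  have p0 : 0 <= fine (P D) by rewrite fine_ge0.
  by exists (NngNum p0); rewrite /= fineK// fin_num_measure.
rewrite pE muleC -[LHS]/(mrestr P mD A) -[RHS]/(mscale p P A).
apply: (@g_sigma_algebra_measure_unique _ R T G _ (fun=> setT)) => //.
- move=> _ [B [mB ->]]; apply: bigcap_measurableType => i /= ik.
  by rewrite -[X in measurable X]setTI; exact: mY.
- by move=> _; exists (fun=> setT); split => //; rewrite bigcapT.
- by rewrite bigcup_const.
- move=> _ _ [B [mB ->]] [C [mC ->]]; exists (fun i => B i `&` C i); split.
    by move=> i; exact: measurableI.
  by rewrite -bigcapI.
- by move=> B GB; rewrite -[LHS]/(P (B `&` D)) GD// pE muleC.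
- by move=> _; rewrite -[X in (X < _)%E]/(P (setT `&` D)) setTI ltey_eq fin_num_measure.
Qed.

Lemma measurable_g_sigma_cylinders (i : nat) : (i < k)%N ->
  measurable_fun [set: g_sigma_algebraType G] (Y i : g_sigma_algebraType G -> R).
Proof.
move=> ik _ B mB; rewrite setTI; apply: sub_sigma_algebra.
exists (fun j => if j == i then B else setT); split.
  by move=> j; case: ifP.
apply/seteqP; split => [w Bw j /= jk|w /(_ i ik)/=]; last by rewrite eqxx.
by case: eqP => // ->.
Qed.

(** The identity into [T] with the coarser sigma-algebra serves as a random variable that carries
    the entire past. *)
Lemma g_sigma_cylinders_measurable :
  (forall i, (i < k)%N -> measurable_fun [set: T] (Y i)) ->
  measurable_fun [set: T] (id : T -> g_sigma_algebraType G).
Proof.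
move=> mY _ A GA; rewrite setTI.
apply: (smallest_sub (@sigma_algebra_measurable _ T)) GA => _ [B [mB ->]].
apply: bigcap_measurableType => i /= ik.
by rewrite -[X in measurable X]setTI; exact: mY.
Qed.

End cylinders.

Section independent_increments.
Context d (T : measurableType d) {R : realType} (P : probability T R).
Variable X : R -> T -> R.
Hypothesis Xbm : brownian_motion P X.
Variables (u : nat -> R) (k : nat).
Hypotheses (u0 : 0 <= u 0%N) (und : forall i, u i <= u i.+1) (uk : u k <= 1).
Let Y i w := X (u i.+1) w - X (u i) w.

Lemma grid_ge0 i : 0 <= u i.
Proof. by elim: i => // i IH; exact: le_trans IH (und i). Qed.

Lemma grid_le i j : (i <= j)%N -> u i <= u j.
Proof.
by move=> ij; have /nondecreasing_seqP := und; exact.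
Qed.

Lemma measurable_grid i : (i <= k)%N -> measurable_fun [set: T] (X (u i)).
Proof.
move=> ik; apply: bm_measurable Xbm _ _.
by rewrite grid_ge0 (le_trans (grid_le ik)).
Qed.

Lemma measurable_grid_increment i : (i < k)%N -> measurable_fun [set: T] (Y i).
Proof. by move=> ik; apply: measurable_funB; apply: measurable_grid => //; exact: ltnW. Qed.

(** With 1 appended as a further grid point, [Z] is the last of [k + 1] increments. Their product
    rule gives independence on cylinders, which extends to the generated sigma-algebra. *)
Lemma indep_future_increment (A : set T) (B : set R) :
  <<s cylinders measurable k Y >> A -> measurable B ->
  let Z w := X 1 w - X (u k) w in
  P (A `&` Z @^-1` B) = (P A * P (Z @^-1` B))%E.
Proof.
move=> GA mB Z.
have mZ : measurable_fun [set: T] Z.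
  apply: measurable_funB; last exact: measurable_grid.
  by apply: bm_measurable Xbm _ _; rewrite ler01 lexx.
apply: indep_g_sigma_cylinders GA.
- by rewrite -[X in measurable X]setTI; exact: mZ.
- exact: measurable_grid_increment.
move=> _ [C [mC ->]].
pose t i := if (i <= k)%N then u i else 1.
have : independent_increments P X := bm_independent_increments Xbm.
move=> /(_ k.+1 t).
rewrite /t leq0n ltnn => /(_ u0 _ (lexx _)).
have ht i : (i < k.+1)%N -> (if (i <= k)%N then u i else 1) <= (if (i.+1 <= k)%N then u i.+1 else 1).
  rewrite ltnS => ik; rewrite ik; case: ifP => // /negbT; rewrite -ltnNge ltnS => ki.
  by rewrite (_ : i = k)//; apply/eqP; rewrite eqn_leq ik.
move=> /(_ ht) ind.
have prod D : measurable D -> P (\bigcap_(i < k) (Y i @^-1` C i) `&` Z @^-1` D)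
    = ((\prod_(i < k) P (Y i @^-1` C i)) * P (Z @^-1` D))%E.
  move=> mD.
  have := ind (fun i => if (i < k)%N then C i else D).
  move=> /(_ (fun i => ltac:(case: ifP => //))).
  rewrite big_ord_recr/= !ltnn leqnn.
  under eq_bigr do rewrite ltn_ord (ltnW (ltn_ord _)).
  move=> <-; congr (P _); apply/seteqP; split.
    move=> w [h1 h2] i _ /=.
    have /orP[/eqP ik|ik] : (nat_of_ord i == k) || (i < k)%N by rewrite -leq_eqVlt -ltnS.
      by rewrite ik ltnn leqnn.
    by rewrite ik (ltnW ik); exact: h1.
  move=> w h; split; last first.
    by have := h ord_max Logic.I; rewrite /= ltnn leqnn.
  move=> i ik; have := h (widen_ord (leqnSn k) (Ordinal ik)) Logic.I.
  by rewrite /= ik (ltnW ik).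
(* The choice [D = setT] identifies the product over [i < k] with the probability of the
   cylinder. *)
rewrite prod// -[X in (P X * _)%E]setIT -(preimage_setT Z) prod//.
by rewrite preimage_setT probability_setT mule1.
Qed.

End independent_increments.

(** * Running extrema on a grid *)

Fixpoint running_max {R : realType} (s : nat -> R) (n : nat) : R :=
  if n is k.+1 then Num.max (running_max s k) (s k.+1) else s 0%N.

Fixpoint running_min {R : realType} (s : nat -> R) (n : nat) : R :=
  if n is k.+1 then Num.min (running_min s k) (s k.+1) else s 0%N.

Section running.
Context {R : realType}.
Implicit Types (s : nat -> R) (n i : nat).

Lemma le_running_max s n i : (i <= n)%N -> s i <= running_max s n.
Proof.
elim: n => [|n IH] /=; first by rewrite leqn0 => /eqP ->.
by rewrite leq_eqVlt le_max => /orP[/eqP ->|/IH ->]; rewrite ?lexx ?orbT.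
Qed.

Lemma ge_running_min s n i : (i <= n)%N -> running_min s n <= s i.
Proof.
elim: n => [|n IH] /=; first by rewrite leqn0 => /eqP ->.
by rewrite leq_eqVlt ge_min => /orP[/eqP ->|/IH ->]; rewrite ?lexx ?orbT.
Qed.

Lemma running_min_le_max s n : running_min s n <= running_max s n.
Proof. exact: le_trans (ge_running_min s (leq0n n)) (le_running_max s (leq0n n)). Qed.

Lemma measurable_running_max d (T : measurableType d) (s : nat -> T -> R) n :
  (forall i, (i <= n)%N -> measurable_fun [set: T] (s i)) ->
  measurable_fun [set: T] (fun w => running_max (s ^~ w) n).
Proof.
elim: n => [|n IH] ms /=; first exact: ms.
apply: measurable_maxr; last exact: ms.
by apply: IH => i ni; apply: ms; exact: leqW.
Qed.

Lemma measurable_running_min d (T : measurableType d) (s : nat -> T -> R) n :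
  (forall i, (i <= n)%N -> measurable_fun [set: T] (s i)) ->
  measurable_fun [set: T] (fun w => running_min (s ^~ w) n).
Proof.
elim: n => [|n IH] ms /=; first exact: ms.
apply: measurable_minr; last exact: ms.
by apply: IH => i ni; apply: ms; exact: leqW.
Qed.

End running.

(** * The expected potential along a grid *)

Lemma shift_monotone_normal {R : realType} (s : R) : s != 0 ->
  shift_monotone (normal_prob 0 s : probability (measurableTypeR R) R).
Proof. by move=> s0 Q mQ Q0 Qm a b ab; exact: le_integral_normal_prob_shift. Qed.

Lemma shift_monotone_dirac {R : realType} :
  shift_monotone (\d_(0 : measurableTypeR R) : probability (measurableTypeR R) R).
Proof.
move=> Q mQ Q0 Qm a b ab.
have mS e : measurable_fun [set: measurableTypeR R] (fun z => (Q (z + e))%:E).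
  by apply/measurable_EFinP/measurableT_comp => //; exact: measurable_funD.
by rewrite !integral_dirac//= diracT !mul1e !add0r lee_fin Qm.
Qed.

Section grid_step.
Context d (T : measurableType d) {R : realType} (P : probability T R).
Variable X : R -> T -> R.
Hypothesis Xbm : brownian_motion P X.
Variables (u : nat -> R).
Hypotheses (u0 : 0 <= u 0%N) (und : forall i, u i <= u i.+1).
Let S i w := X (u i) w - X (u 0%N) w.

(** For [t < 1] the law is a nondegenerate centered normal one; for [t = 1] the increment is
    identically 0. *)
Lemma future_increment_law (t : R) : 0 <= t <= 1 ->
  exists2 nu : probability (measurableTypeR R) R, shift_monotone nu &
    forall B : set R, measurable B -> P ((fun w => X 1 w - X t w) @^-1` B) = nu B.
Proof.
move=> /andP[t0]; rewrite le_eqVlt => /predU1P[->|t1].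
  exists (\d_(0 : measurableTypeR R)); first exact: shift_monotone_dirac.
  move=> B mB; rewrite (_ : (fun w => _) = cst 0); last by apply/funext => w; rewrite subrr.
  by rewrite preimage_cst /= diracE; case: ifP => _; rewrite ?measure0 ?probability_setT.
have s0 : Num.sqrt (1 - t) != 0 by rewrite gt_eqF// sqrtr_gt0 subr_gt0.
exists (normal_prob 0 (Num.sqrt (1 - t))); first exact: shift_monotone_normal.
by move=> B mB; rewrite (bm_normal_increments Xbm t0 t1 (lexx _) mB).
Qed.

Context (Q : R -> R) (c : R).
Hypotheses (mQ : measurable_fun [set: R] Q) (Q0 : forall x, 0 <= Q x)
  (Qm : forall x y, `|x| <= `|y| -> Q x <= Q y)
  (Qc : forall z, `|z| + `|z - c| - c <= Q z + Q (z - c)) (c0 : 0 <= c).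

Lemma measurable_increment_sum k i : (i <= k)%N ->
  let G := cylinders measurable k (fun i w => X (u i.+1) w - X (u i) w) in
  measurable_fun [set: g_sigma_algebraType G] (S i : g_sigma_algebraType G -> R).
Proof.
move=> + G; elim: i => [_|i IH ik].
  by rewrite /S (_ : (fun w => _) = cst 0)//; apply/funext => w; rewrite subrr.
have -> : S i.+1 = (fun w => S i w + (X (u i.+1) w - X (u i) w)).
  by apply/funext => w; rewrite /S; ring.
exact: (measurable_funD (IH (ltnW ik))
  (measurable_g_sigma_cylinders (Y := fun i w => X (u i.+1) w - X (u i) w) ik)).
Qed.

(** Given the first [k + 1] increments, the final position is [S k.+1] plus an independent increment
    with a shift-monotone law. The inequality therefore holds with the past frozen, by
    [le_integral_range_potential] at [x = S k.+1]. *)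
Lemma le_integral_range_potential_step k : u k.+1 <= 1 ->
  (\int[P]_w (range_potential Q c (running_max (S ^~ w) k.+1) (running_min (S ^~ w) k.+1)
     (X 1 w - X (u 0%N) w))%:E <=
   \int[P]_w (range_potential Q c (running_max (S ^~ w) k) (running_min (S ^~ w) k)
     (X 1 w - X (u 0%N) w))%:E)%E.
Proof.
move=> uk.
have uk0 : 0 <= u k.+1 by exact: grid_ge0.
have /future_increment_law[nu num nuE] : 0 <= u k.+1 <= 1 by rewrite uk0.
pose Y i w := X (u i.+1) w - X (u i) w.
pose G := cylinders measurable k.+1 Y.
have mY i : (i < k.+1)%N -> measurable_fun [set: T] (Y i).
  by move=> ik; exact: (measurable_grid_increment Xbm u0 und uk ik).
have mid := g_sigma_cylinders_measurable mY.
pose Z : {mfun T >-> g_sigma_algebraType G} := mfun_Sub (mem_set mid).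
have mzeta : measurable_fun [set: T] ((fun w => X 1 w - X (u k.+1) w) : T -> measurableTypeR R).
  by apply: measurable_funB; apply: bm_measurable Xbm _ _; rewrite ?ler01 ?lexx ?uk0.
pose zeta : {mfun T >-> measurableTypeR R} := @mfun_Sub _ _ T (measurableTypeR R) _ (mem_set mzeta).
pose f (sz : g_sigma_algebraType G * measurableTypeR R) : \bar R :=
  (range_potential Q c (Num.max (running_max (S ^~ sz.1) k) (S k.+1 sz.1))
    (Num.min (running_min (S ^~ sz.1) k) (S k.+1 sz.1)) (S k.+1 sz.1 + sz.2))%:E.
pose g (sz : g_sigma_algebraType G * measurableTypeR R) : \bar R :=
  (range_potential Q c (running_max (S ^~ sz.1) k)
    (running_min (S ^~ sz.1) k) (S k.+1 sz.1 + sz.2))%:E.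
have Sz w : X 1 w - X (u 0%N) w = S k.+1 (Z w) + zeta w by rewrite /S /=; ring.
under eq_integral do rewrite Sz.
under [X in (_ <= X)%E]eq_integral do rewrite Sz.
have mM := measurable_running_max (n := k) (fun i ik => measurable_increment_sum (leqW ik)).
have mm := measurable_running_min (n := k) (fun i ik => measurable_increment_sum (leqW ik)).
have mS := measurable_increment_sum (leqnn k.+1).
have m1 (h : g_sigma_algebraType G -> R) : measurable_fun [set: g_sigma_algebraType G] h ->
    measurable_fun [set: g_sigma_algebraType G * measurableTypeR R] (fun sz => h sz.1).
  by move=> mh; exact: measurableT_comp.
apply: (@le_integral_indep _ _ _ _ _ _ _ _ nu Z zeta f g).
- move=> A B mA mB; rewrite -[nu B]nuE//.
  by rewrite (indep_future_increment Xbm u0 und uk).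
- apply/measurable_EFinP/measurable_range_potential => //.
  + exact: (measurable_maxr (m1 _ mM) (m1 _ mS)).
  + exact: (measurable_minr (m1 _ mm) (m1 _ mS)).
  + exact: (measurable_funD (m1 _ mS) measurable_snd).
- by move=> x; rewrite lee_fin range_potential_ge0.
- apply/measurable_EFinP/measurable_range_potential => //.
  + exact: (m1 _ mM).
  + exact: (m1 _ mm).
  + exact: (measurable_funD (m1 _ mS) measurable_snd).
- by move=> x; rewrite lee_fin range_potential_ge0.
- move=> s; exact: (le_integral_range_potential mQ Q0 Qm Qc c0 num (S k.+1 s)
    (running_min_le_max (S ^~ s) k)).
Qed.

(** At the last grid point the final position lies between the extrema, so the potential dominates
    the integrand. Going back along the grid can only raise its expectation, and at the single point
    [u 0] it is explicit. *)
Lemma integral_max_range_le n : u n = 1 ->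
  (\int[P]_w (Num.max (running_max (S ^~ w) n - running_min (S ^~ w) n) c)%:E <=
   \int[P]_w (Q (X 1 w - X (u 0%N) w) + Q (X 1 w - X (u 0%N) w) + c)%:E)%E.
Proof.
move=> un.
have u1 i : (i <= n)%N -> u i <= 1 by move=> ni; rewrite -un; exact: grid_le.
have mX i : (i <= n)%N -> measurable_fun [set: T] (X (u i)).
  by move=> ni; apply: bm_measurable Xbm _ _; rewrite u1// grid_ge0.
have mS i : (i <= n)%N -> measurable_fun [set: T] (S i).
  by move=> ni; apply: measurable_funB; apply: mX.
have mN : measurable_fun [set: T] (fun w => X 1 w - X (u 0%N) w).
  by rewrite -un; exact: mS.
have mpot k : (k <= n)%N -> measurable_fun [set: T] (fun w => range_potential Q c
    (running_max (S ^~ w) k) (running_min (S ^~ w) k) (X 1 w - X (u 0%N) w)).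
  move=> kn; apply: measurable_range_potential => //.
    by apply: measurable_running_max => i ik; exact/mS/(leq_trans ik).
  by apply: measurable_running_min => i ik; exact/mS/(leq_trans ik).
apply: (@le_trans _ _ (\int[P]_w (range_potential Q c (running_max (S ^~ w) n)
    (running_min (S ^~ w) n) (X 1 w - X (u 0%N) w))%:E)%E).
  apply: ge0_le_integral => //=.
  - by move=> w _; rewrite lee_fin le_max c0 orbT.
  - apply/measurable_EFinP; apply: measurable_maxr => //; apply: measurable_funB.
      exact: measurable_running_max.
    exact: measurable_running_min.
  - by apply/measurable_EFinP; exact: mpot.
  - move=> w _; rewrite lee_fin; apply: le_range_potential => //.
    by rewrite -un; apply/andP; split; [exact: (ge_running_min (S ^~ w))|exact: (le_running_max (S ^~ w))].
have {}mpot := mpot 0%N isT.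
apply: (@le_trans _ _ (\int[P]_w (range_potential Q c (running_max (S ^~ w) 0)
    (running_min (S ^~ w) 0) (X 1 w - X (u 0%N) w))%:E)%E).
  elim: n u1 {un mX mS} => // n IH u1.
  apply: le_trans (le_integral_range_potential_step (u1 n.+1 _)) _ => //.
  by apply: IH => i ni; apply: u1; exact: leqW.
apply: ge0_le_integral => //=.
- by move=> w _; rewrite lee_fin range_potential_ge0.
- exact/measurable_EFinP.
- by apply/measurable_EFinP; apply: measurable_funD => //; apply: measurable_funD; exact: measurableT_comp.
(* Both extrema are 0 here, so the second form of the potential occurs only for [c = 0], where [Qc]
   bounds it by the first. *)
- move=> w _; rewrite lee_fin /range_potential /S !subrr !subr0.
  case: ltP => // cc; have -> : c = 0 by apply/eqP; rewrite eq_le cc c0.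
  by have := Qc (X 1 w - X (u 0%N) w); rewrite (_ : c = 0) ?subr0 ?addr0//; apply/eqP; rewrite eq_le cc c0.
Qed.

End grid_step.

(** * Integration over the excess level *)

Section integral_pospart.
Context {R : realType}.
Notation mu := (@lebesgue_measure R).

(** This is the area of a right triangle with legs [x] and [x / a], as the integrand vanishes beyond
    [x / a]. *)
Lemma integral_pospart_affine (x a : R) : 0 <= x -> 0 < a ->
  (\int[mu]_(c in `[0%R, +oo[) (Num.max 0 (x - a * c))%:E = (x ^+ 2 / (2 * a))%:E)%E.
Proof.
move=> x0 a0; have [->|xn0] := eqVneq x 0.
  rewrite expr0n mul0r integral0_eq// => c /=; rewrite in_itv/= andbT => c0.
  by rewrite max_l// sub0r oppr_le0 mulr_ge0// ltW.
have xa : 0 < x / a by rewrite divr_gt0// lt0r xn0.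
have -> : (\int[mu]_(c in `[0%R, +oo[) (Num.max 0 (x - a * c))%:E =
    \int[mu]_(c in `[0%R, (x / a)%R]) (x - a * c)%:E)%E.
  rewrite integral_mkcond [RHS]integral_mkcond; apply: eq_integral => c _.
  rewrite !patchE !mem_setE !in_itv/= andbT; case: leP => //= c0.
  rewrite ler_pdivlMr//; have [h|h] := leP (c * a) x.
    by rewrite max_r//; lra.
  by rewrite max_l; [by []|lra].
have cf : {within `[0, x / a], continuous (fun c : R => x - a * c)}.
  apply: continuous_subspaceT => c; apply: cvgB; first exact: cvg_cst.
  by apply: cvgM; [exact: cvg_cst|exact: cvg_id].
pose F (c : R) : R := x * c - (a / 2) * (c * c).
have dF (c : R) : is_derive c 1 F (x - a * c).
  by rewrite /F; apply: is_derive_eq; rewrite /GRing.scale/=; field.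
have cF : continuous F.
  by move=> c; apply: differentiable_continuous; apply/derivable1_diffP; have [] := dF c.
rewrite (continuous_FTC2 xa cf (F := F)).
- by rewrite /F -EFinB; congr _%:E; field; rewrite gt_eqF.
- split.
  + by move=> c _; have [] := dF c.
  + by apply: cvg_at_right_filter; exact: cF.
  + by apply: cvg_at_left_filter; exact: cF.
- by move=> c _; rewrite derive1E; have [_ ->] := dF c.
Qed.

(** Tonelli moves the integral over [c] outside, where the levels can be compared one by one. In [g]
    an indicator confines [c] to the half-line. *)
Lemma le_integral_tonelli d (T : measurableType d) (P : probability T R)
    (F1 F2 : T * R -> R) :
  measurable_fun [set: T * R] F1 -> measurable_fun [set: T * R] F2 ->
  (forall x, 0 <= F1 x) -> (forall x, 0 <= F2 x) ->
  (forall c : R, (0 <= c)%R -> \int[P]_w (F1 (w, c))%:E <= \int[P]_w (F2 (w, c))%:E)%E ->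
  (\int[P]_w \int[mu]_(c in `[0%R, +oo[) (F1 (w, c))%:E <=
   \int[P]_w \int[mu]_(c in `[0%R, +oo[) (F2 (w, c))%:E)%E.
Proof.
move=> mF1 mF2 F10 F20 F12.
pose g (F : T * R -> R) (x : T * R) : \bar R := (F x * \1_(`[0, +oo[%classic : set R) x.2)%:E.
have g0 (F : T * R -> R) : (forall x, 0 <= F x) -> forall x, (0 <= g F x)%E.
  by move=> F0 x; rewrite lee_fin mulr_ge0.
have mg (F : T * R -> R) : measurable_fun [set: T * R] F -> measurable_fun [set: T * R] (g F).
  move=> mF; apply/measurable_EFinP/measurable_funM => //.
  by apply: measurableT_comp => //; exact: measurable_indic.
have swap (F : T * R -> R) : measurable_fun [set: T * R] F -> (forall x, 0 <= F x) ->
    (\int[P]_w \int[mu]_(c in `[0%R, +oo[) (F (w, c))%:E = \int[mu]_c \int[P]_w g F (w, c))%E.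
  move=> mF F0; rewrite -(fubini_tonelli (m1 := P) (m2 := mu) (g F) (mg _ mF) (g0 _ F0)).
  apply: eq_integral => w _; rewrite integral_mkcond; apply: eq_integral => c _.
  by rewrite patchE /g/= indicE; case: ifP => _; rewrite ?mulr1 ?mulr0.
rewrite !swap//; apply: ge0_le_integral => //.
- by move=> c _; apply: integral_ge0 => w _; exact: g0.
- exact: (measurable_fun_fubini_tonelli_G (m1 := P) (g F1) (mg _ mF1) (g0 _ F10)).
- exact: (measurable_fun_fubini_tonelli_G (m1 := P) (g F2) (mg _ mF2) (g0 _ F20)).
move=> c _; rewrite /g/= indicE mem_setE in_itv/= andbT.
have [c0|c0] := leP 0 c.
  by under eq_integral do rewrite mulr1; under [X in (_ <= X)%E]eq_integral do rewrite mulr1; exact: F12.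
by under eq_integral do rewrite mulr0; under [X in (_ <= X)%E]eq_integral do rewrite mulr0.
Qed.

End integral_pospart.

(** * The second moment of the range *)

Section alternating_harmonic.
Context {R : realType}.

(** Each step is [1 / (n + 1) <= ln ((n + 1) / n)], that is, [ln (1 + x) <= x] at
    [x = - 1 / (n + 1)]. *)
Lemma harmonic_le_ln m n : (0 < m)%N -> (m <= n)%N ->
  \sum_(i < n) i.+1%:R^-1 - \sum_(i < m) i.+1%:R^-1 <= ln n%:R - ln m%:R :> R.
Proof.
move=> m0; elim: n => [|n IH]; first by rewrite leqn0 => /eqP mE; rewrite mE in m0.
rewrite leq_eqVlt => /predU1P[->|]; first by rewrite !subrr.
rewrite ltnS => mn; have n0 : (0 < n)%N by exact: leq_trans mn.
rewrite big_ord_recr/=.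
have n1 : 0 < n%:R :> R by rewrite ltr0n.
have n2 : 0 < n.+1%:R :> R by rewrite ltr0n.
have : ln (1 + - n.+1%:R^-1) <= - n.+1%:R^-1 :> R.
  by apply: le_ln1Dx; rewrite ltrN2 invf_lt1// ltr1n ltnS.
rewrite (_ : 1 + - n.+1%:R^-1 = n%:R / n.+1%:R :> R); last first.
  by rewrite -[n.+1%:R]natr1; field; rewrite natr1 gt_eqF.
rewrite ln_div ?posrE//; have := IH mn.
move: (_^-1) (\sum_(i < n) _) (\sum_(i < m) _) (ln _) (ln _) (ln _) => *; lra.
Qed.

(** Apart from the last term [1 / (2 n + 1)], the alternating sum is a difference [H_(2 n) - H_n] of
    harmonic numbers, at most [ln (2 n) - ln n] for positive [n]. *)
Lemma alternating_harmonic_le_ln2 n :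
  \sum_(i < n.+1) i.*2.+1%:R^-1 - \sum_(i < n) i.*2.+2%:R^-1 <= ln 2 + n.*2.+1%:R^-1 :> R.
Proof.
rewrite big_ord_recr /= addrAC lerD2r.
have -> : \sum_(i < n) i.*2.+1%:R^-1 - \sum_(i < n) i.*2.+2%:R^-1
    = \sum_(i < n.*2) i.+1%:R^-1 - \sum_(i < n) i.+1%:R^-1 :> R.
  elim: n => [|n IH]; first by rewrite !big_ord0.
  rewrite doubleS big_ord_recr/= [\sum_(i < n.+1) i.*2.+2%:R^-1]big_ord_recr/=.
  rewrite [\sum_(i < n.*2.+2) _]big_ord_recr/= [\sum_(i < n.*2.+1) _]big_ord_recr/=.
  rewrite [\sum_(i < n.+1) i.+1%:R^-1]big_ord_recr/=.
  have -> : n.*2.+2%:R = 2 * n.+1%:R :> R by rewrite -natrM mul2n doubleS.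
  have -> : (2 * n.+1%:R)^-1 = n.+1%:R^-1 / 2 :> R by rewrite invfM mulrC.
  move: IH; move: (n.*2.+1%:R^-1) (n.+1%:R^-1) (\sum_(i < n) _) (\sum_(i < n) _).
  by move: (\sum_(i < n) _) (\sum_(i < n.*2) _) => *; lra.
case: n => [|n]; first by rewrite !big_ord0 subrr ln_ge0// ler1n.
apply: le_trans (harmonic_le_ln (m := n.+1) (n := n.+1.*2) isT _) _.
  by rewrite -addnn leq_addr.
by rewrite -mul2n natrM lnM ?posrE ?ltr0n// addrK.
Qed.

End alternating_harmonic.

(** * From the expected excess to the second moment *)

Section range_second_moment.
Context d (T : measurableType d) {R : realType} (P : probability T R).
Variable X : R -> T -> R.
Hypothesis Xbm : brownian_motion P X.
Notation mu := (@lebesgue_measure R).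

Lemma integral_sum_pospart_affine n (a : nat -> R) (x : R) : 0 <= x -> (forall i, 0 < a i) ->
  (\int[mu]_(c in `[0%R, +oo[) (\sum_(i < n) 4 * Num.max 0 (x - a i * c))%:E
   = (x ^+ 2 * \sum_(i < n) 2 / a i)%:E)%E.
Proof.
move=> x0 a0.
under eq_integral do rewrite -sumEFin.
have mf i : measurable_fun [set: R] (fun c => Num.max 0 (x - a i * c)).
  by apply: measurable_maxr => //; exact: measurable_funB.
rewrite ge0_integral_sum//; last 2 first.
  by move=> i; apply/measurable_funTS/measurable_EFinP; exact: (measurable_funM (measurable_cst _) (mf i)).
  by move=> i c _; rewrite lee_fin mulr_ge0// le_max lexx.
rewrite mulr_sumr -sumEFin; apply: eq_bigr => i _.
under eq_integral do rewrite EFinM.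
rewrite ge0_integralZl//; last 2 first.
  by apply/measurable_funTS/measurable_EFinP; exact: mf.
  by move=> c _; rewrite lee_fin le_max lexx.
rewrite integral_pospart_affine// -EFinM; congr _%:E.
by field; rewrite gt_eqF.
Qed.

Lemma integral_sqr_increment01_le1 : (\int[P]_w ((X 1 w - X 0 w) ^+ 2)%:E <= 1)%E.
Proof.
have mX : measurable_fun [set: T] ((fun w => X 1 w - X 0 w) : T -> measurableTypeR R).
  by apply: measurable_funB; apply: bm_measurable Xbm _ _; rewrite ?ler01 ?lexx.
pose N : {mfun T >-> measurableTypeR R} := @mfun_Sub _ _ T (measurableTypeR R) _ (mem_set mX).
apply: le_trans (integral_sqr_normal01_le1).
rewrite (eq_measure_integral (distribution P N)); last first.
  move=> A mA _; have := bm_normal_increments Xbm (lexx 0) ltr01 (lexx 1) mA.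
  by rewrite subr0 sqrtr1.
rewrite ge0_integral_pushforward//.
  by apply/measurable_EFinP; exact: measurable_funX.
by move=> y _; rewrite lee_fin sqr_ge0.
Qed.

Variables (u : nat -> R) (n : nat).
Hypotheses (u0 : u 0%N = 0) (und : forall i, u i <= u i.+1) (un : u n = 1).
Let S i w := X (u i) w - X 0 w.
Let range w := running_max (S ^~ w) n - running_min (S ^~ w) n.
Let N w := X 1 w - X 0 w.

Let range_ge0 w : 0 <= range w.
Proof. by rewrite subr_ge0 running_min_le_max. Qed.

Lemma measurable_grid_range : measurable_fun [set: T] range.
Proof.
have mS i : (i <= n)%N -> measurable_fun [set: T] (S i).
  move=> ni; apply: measurable_funB; apply: bm_measurable Xbm _ _; rewrite ?lexx ?ler01//.
  by rewrite grid_ge0 ?u0// -un grid_le.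
by apply: measurable_funB; [exact: measurable_running_max|exact: measurable_running_min].
Qed.

Let mN : measurable_fun [set: T] N.
Proof. by apply: measurable_funB; apply: bm_measurable Xbm _ _; rewrite ?ler01 ?lexx. Qed.

(** This is [integral_max_range_le] for [Q = fold_fun K c], with [c] cancelled through
    [max(r, c) = max(0, r - c) + c] and the negative terms moved to the left. The coefficient 4 is
    the 2 of [fold_fun] doubled, as each end of the range contributes [Q (N w)]. *)
Lemma integral_range_excess_le K (c : R) : 0 <= c ->
  (\int[P]_w (Num.max 0 (range w - c) +
      \sum_(i < K) 4 * Num.max 0 (`|N w| - i.*2.+2%:R * c))%:E <=
   \int[P]_w (\sum_(i < K.+1) 4 * Num.max 0 (`|N w| - i.*2.+1%:R * c))%:E)%E.
Proof.
move=> c0; pose Q := fold_fun K c.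
have mpos (a : R) (h : T -> R) : measurable_fun [set: T] h ->
    measurable_fun [set: T] (fun w => Num.max 0 (h w - a)).
  by move=> mh; apply: measurable_maxr => //; exact: measurable_funB.
have msum (n' : nat) (a : nat -> R) :
    measurable_fun [set: T] (fun w => \sum_(i < n') 4 * Num.max 0 (`|N w| - a i)).
  apply: measurable_sum => i; apply: measurable_funM => //.
  by apply: (mpos (a i) (fun w => `|N w|)); exact: measurableT_comp.
have sum0 (n' : nat) (a : nat -> R) w : 0 <= \sum_(i < n') 4 * Num.max 0 (`|N w| - a i).
  by apply: sumr_ge0 => i _; rewrite mulr_ge0// le_max lexx.
have mQ : measurable_fun [set: R] Q.
  apply: measurable_funM => //; apply: measurable_sum => i; apply: measurable_funM => //.
  by apply: measurable_maxr => //; apply: measurable_funB => //; exact: measurableT_comp.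
have Q0 x : 0 <= Q x by exact: fold_fun_ge0.
have mQN : measurable_fun [set: T] (fun w => Q (N w)) by exact: measurableT_comp.
have mrc := mpos c _ measurable_grid_range.
have rc0 w : 0 <= Num.max 0 (range w - c) by rewrite le_max lexx.
have main : (\int[P]_w (Num.max 0 (range w - c))%:E <= \int[P]_w (Q (N w) + Q (N w))%:E)%E.
  have u00 : 0 <= u 0%N by rewrite u0.
  have := integral_max_range_le Xbm u00 und mQ Q0 (fun x y => fold_fun_mono K c0)
    (fun z => fold_fun_ge K z c0) c0 un.
  have Dc (h : T -> R) : measurable_fun [set: T] h -> (forall w, 0 <= h w) ->
      (\int[P]_w (h w + c)%:E = \int[P]_w (h w)%:E + c%:E)%E.
    move=> mh h0; under eq_integral do rewrite EFinD.
    rewrite ge0_integralD//.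
    - by rewrite integral_cst// [X in (_ * X)%E](probability_setT P) mule1.
    - by move=> w _; rewrite lee_fin.
    - exact/measurable_EFinP.
  rewrite u0 Dc; last 2 first.
  - exact: measurable_funD.
  - by move=> w; rewrite addr_ge0.
  under eq_integral => w _.
    rewrite (_ : Num.max _ c = Num.max 0 (range w - c) + c); last first.
      by rewrite addr_maxl add0r subrK maxC.
    over.
  by rewrite Dc// leeD2rE.
have sumE w : \sum_(i < K.+1) 4 * Num.max 0 (`|N w| - i.*2.+1%:R * c) =
    (Q (N w) + Q (N w)) + \sum_(i < K) 4 * Num.max 0 (`|N w| - i.*2.+2%:R * c).
  have := fold_fun_split K c (N w); rewrite -/Q => h.
  have e k (a : nat -> R) : \sum_(i < k) 4 * Num.max 0 (`|N w| - a i)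
      = 2 * \sum_(i < k) 2 * Num.max 0 (`|N w| - a i).
    by rewrite mulr_sumr; apply: eq_bigr => i _; rewrite mulrA -natrM.
  rewrite (e _ (fun i => i.*2.+1%:R * c)) (e _ (fun i => i.*2.+2%:R * c)) -h; ring.
under [X in (_ <= X)%E]eq_integral do rewrite sumE.
have D (f g : T -> R) : measurable_fun [set: T] f -> (forall w, 0 <= f w) ->
    measurable_fun [set: T] g -> (forall w, 0 <= g w) ->
    (\int[P]_w (f w + g w)%:E = \int[P]_w (f w)%:E + \int[P]_w (g w)%:E)%E.
  move=> mf f0 mg g0; under eq_integral do rewrite EFinD.
  rewrite ge0_integralD//.
  - by move=> w _; rewrite lee_fin.
  - exact/measurable_EFinP.
  - by move=> w _; rewrite lee_fin.
  - exact/measurable_EFinP.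
have mneg := msum K (fun i => i.*2.+2%:R * c).
have neg0 := sum0 K (fun i => i.*2.+2%:R * c).
rewrite (D _ _ mrc rc0 mneg neg0) (D _ _ (measurable_funD mQN mQN) _ mneg neg0); last first.
  by move=> w; rewrite addr_ge0.
exact: leeD2r.
Qed.

(** Integrating the excess inequality over [c] gives [E r^2 / 2 + al E N^2 <= be E N^2], where
    [be - al] is twice a partial alternating harmonic sum and [E N^2 <= 1]. *)
Lemma integral_sqr_range_le_partial K :
  (\int[P]_w (range w ^+ 2)%:E <= (4 * (ln 2 + K.*2.+1%:R^-1))%:E)%E.
Proof.
pose F1 (x : T * R) := Num.max 0 (range x.1 - x.2) +
      \sum_(i < K) 4 * Num.max 0 (`|N x.1| - i.*2.+2%:R * x.2).
pose F2 (x : T * R) := \sum_(i < K.+1) 4 * Num.max 0 (`|N x.1| - i.*2.+1%:R * x.2).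
have sum0 (n' : nat) (a : nat -> R) (x : T * R) :
    0 <= \sum_(i < n') 4 * Num.max 0 (`|N x.1| - a i * x.2).
  by apply: sumr_ge0 => i _; rewrite mulr_ge0// le_max lexx.
have mpos (a : R) (h : T -> R) : measurable_fun [set: T] h ->
    measurable_fun [set: T * R] (fun x => Num.max 0 (h x.1 - a * x.2)).
  move=> mh; apply: measurable_maxr => //; apply: measurable_funB.
    exact: measurableT_comp.
  exact: measurable_funM.
have mNn : measurable_fun [set: T] (fun w => `|N w|) by exact: measurableT_comp.
have msum (n' : nat) (a : nat -> R) : measurable_fun [set: T * R]
    (fun x => \sum_(i < n') 4 * Num.max 0 (`|N x.1| - a i * x.2)).
  apply: measurable_sum => i; apply: measurable_funM => //.
  exact: (mpos (a i) (fun w => `|N w|)).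
have mF1 : measurable_fun [set: T * R] F1.
  apply: measurable_funD; last exact: (msum K (fun i => i.*2.+2%:R)).
  have := mpos 1 _ measurable_grid_range.
  by under eq_fun do rewrite mul1r.
have mF2 : measurable_fun [set: T * R] F2 by exact: (msum K.+1 (fun i => i.*2.+1%:R)).
have F10 x : 0 <= F1 x.
  by rewrite addr_ge0 ?(sum0 K (fun i => i.*2.+2%:R))// le_max lexx.
have F20 x : 0 <= F2 x by exact: (sum0 K.+1 (fun i => i.*2.+1%:R)).
have := le_integral_tonelli mF1 mF2 F10 F20 (fun c c0 => integral_range_excess_le K c0).
pose al : R := \sum_(i < K) 2 / i.*2.+2%:R.
pose be : R := \sum_(i < K.+1) 2 / i.*2.+1%:R.
have al0 : 0 <= al by apply: sumr_ge0 => i _; rewrite divr_ge0.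
have be0 : 0 <= be by apply: sumr_ge0 => i _; rewrite divr_ge0.
have I1 w : (\int[mu]_(c in `[0%R, +oo[) (F1 (w, c))%:E
    = (2^-1 * range w ^+ 2)%:E + (al * N w ^+ 2)%:E)%E.
  rewrite /F1/=; under eq_integral do rewrite EFinD.
  rewrite ge0_integralD//=.
  - rewrite (integral_sum_pospart_affine K (normr_ge0 (N w)) (a := fun i => i.*2.+2%:R))//.
    have := integral_pospart_affine (range_ge0 w) (@ltr01 R).
    under eq_integral do rewrite mul1r.
    move=> ->; rewrite mulr1 [_ * 2^-1]mulrC; congr (_ + _%:E)%E.
    by rewrite mulrC -normrX ger0_norm ?sqr_ge0.
  - by move=> c _; rewrite lee_fin le_max lexx.
  - by apply/measurable_funTS/measurable_EFinP; apply: measurable_maxr => //; exact: measurable_funB.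
  - by move=> c _; rewrite lee_fin (sum0 K (fun i => i.*2.+2%:R) (w, c)).
  - apply/measurable_funTS/measurable_EFinP; apply: measurable_sum => i.
    by apply: measurable_funM => //; apply: measurable_maxr => //; apply: measurable_funB.
have I2 w : (\int[mu]_(c in `[0%R, +oo[) (F2 (w, c))%:E = (be * N w ^+ 2)%:E)%E.
  rewrite (integral_sum_pospart_affine K.+1 (normr_ge0 (N w)) (a := fun i => i.*2.+1%:R))//.
  by rewrite mulrC -normrX ger0_norm ?sqr_ge0.
under eq_integral do rewrite I1.
under [X in (_ <= X)%E -> _]eq_integral do rewrite I2.
have mN2 : measurable_fun [set: T] (fun w => (N w ^+ 2)%:E).
  by apply/measurable_EFinP; exact: measurable_funX.
have mr2 : measurable_fun [set: T] (fun w => (range w ^+ 2)%:E).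
  by apply/measurable_EFinP; apply: measurable_funX; exact: measurable_grid_range.
have N20 w : (0 <= (N w ^+ 2)%:E)%E by rewrite lee_fin sqr_ge0.
have r20 w : (0 <= (range w ^+ 2)%:E)%E by rewrite lee_fin sqr_ge0.
rewrite ge0_integralD//; first last.
- by under eq_fun do rewrite EFinM; exact: measurable_funeM.
- by move=> w _; rewrite EFinM mule_ge0.
- by under eq_fun do rewrite EFinM; exact: measurable_funeM.
- by move=> w _; rewrite EFinM mule_ge0.
under eq_integral do rewrite EFinM.
under [X in (_ + X <= _)%E -> _]eq_integral do rewrite EFinM.
under [X in (_ <= X)%E -> _]eq_integral do rewrite EFinM.
rewrite !ge0_integralZl//.
(* Finiteness of [E N^2] forces that of [E r^2] and lets the term with [al] be subtracted among real
   numbers. *)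
have v1 := integral_sqr_increment01_le1.
have v0 : (0 <= \int[P]_w (N w ^+ 2)%:E)%E by apply: integral_ge0 => w _; exact: N20.
move: v1 v0; rewrite -/N; case: (\int[P]_w (N w ^+ 2)%:E)%E => [v||]//.
rewrite !lee_fin => v1 v0.
have : (0 <= \int[P]_w (range w ^+ 2)%:E)%E by apply: integral_ge0 => w _; exact: r20.
case: (\int[P]_w (range w ^+ 2)%:E)%E => [r||]//; last first.
  by rewrite mulry gtr0_sg ?invr_gt0// mul1e.
move=> _; rewrite -!EFinM -EFinD !lee_fin => h.
have hl := @alternating_harmonic_le_ln2 R K.
have ab : be - al = 2 * (\sum_(i < K.+1) i.*2.+1%:R^-1 - \sum_(i < K) i.*2.+2%:R^-1).
  by rewrite mulrBr !mulr_sumr.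
have : (be - al) * v <= 2 * (ln 2 + K.*2.+1%:R^-1).
  apply: le_trans (_ : 2 * (ln 2 + K.*2.+1%:R^-1) * v <= _).
    by rewrite ler_wpM2r// ab ler_wpM2l.
  by rewrite ler_piMr// mulr_ge0// addr_ge0// ln_ge0// ler1n.
rewrite mulrBl; move: h; move: (be * v) (al * v) (ln 2) (K.*2.+1%:R^-1) => ? ? ? ? ? ?; lra.
Qed.

Lemma integral_sqr_range_le : (\int[P]_w (range w ^+ 2)%:E <= (4 * ln 2)%:E)%E.
Proof.
apply/lee_addgt0Pr => e e0.
have [K hK] : exists K : nat, 4 / e < K%:R.
  by exists (Num.bound (4 / e)); apply: archi_boundP; rewrite divr_ge0// ltW.
apply: le_trans (integral_sqr_range_le_partial K) _.
rewrite -EFinD lee_fin mulrDr lerD2l ler_pdivrMr ?ltr0n//.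
move: hK; rewrite ltr_pdivrMr// mulrC => /ltW/le_trans; apply.
by apply: ler_wpM2l; [exact: ltW|rewrite ler_nat -addnn -addnS leq_addr].
Qed.

End range_second_moment.

(** * Numerical bounds for ln 2 *)

Section ln2_bounds.
Context {R : realType}.

Lemma expR_ge_partial_sum (x : R) n : 0 <= x -> series (exp_coeff x) n <= expR x.
Proof.
move=> x0; apply: nondecreasing_cvgn_le; last exact: is_cvg_series_exp_coeff.
by apply: nondecreasing_series => i _ _; exact: exp_coeff_ge0.
Qed.

(** On [[0, 1]] each term from degree 1 on is at least twice the next, so the right-hand side is
    nonincreasing in [m]. It dominates all later partial sums, hence their limit. *)
Lemma expR_le_partial_sum (x : R) m : 0 <= x <= 1 -> (0 < m)%N ->
  expR x <= series (exp_coeff x) m + 2 * exp_coeff x m.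
Proof.
move=> /andP[x0 x1] m0.
pose v := fun k => series (exp_coeff x) k + 2 * exp_coeff x k.
have vS k : (0 < k)%N -> v k.+1 <= v k.
  move=> k0; rewrite /v /series /= big_nat_recr//= -addrA lerD2l.
  have := @exp_coeff_ge0 _ x k x0; rewrite /exp_coeff/= => e0.
  have -> : x ^+ k.+1 / k.+1`!%:R = (x ^+ k / k`!%:R) * (x / k.+1%:R) :> R.
    by rewrite factS natrM exprS; field; rewrite !gt_eqF// ltr0n ?fact_gt0.
  suff : x / k.+1%:R <= 2^-1.
    by move: e0; move: (x ^+ k / _) (x / _) => e t e0 t2; nra.
  rewrite ler_pdivrMr ?ltr0n//; have : 2 <= k.+1%:R :> R by rewrite ler_nat ltnS.
  lra.
have vm n : v (m + n)%N <= v m.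
  elim: n => [|n IH]; first by rewrite addn0.
  by rewrite addnS; apply: le_trans (vS _ _) IH; rewrite addn_gt0 m0.
rewrite /expR; apply: limr_le; first exact: is_cvg_series_exp_coeff.
near=> n; apply: (le_trans _ (vm (n - m)%N)).
rewrite subnKC; last by near: n; exact: nbhs_infty_ge.
by rewrite /v lerDl mulr_ge0// exp_coeff_ge0.
Unshelve. all: by end_near. Qed.

Lemma series_exp_coeff7 (x : R) : series (exp_coeff x) 7 =
  1 + x + x ^+ 2 / 2 + x ^+ 3 / 6 + x ^+ 4 / 24 + x ^+ 5 / 120 + x ^+ 6 / 720.
Proof.
rewrite /series/= /exp_coeff/= !big_nat_recr//= big_geq// add0r.
rewrite !factS fact0 !muln1 !natrM expr0 expr1; by field.
Qed.

(** Among six-decimal numbers, this bound and that of [ln2_ub] are the weakest that place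
    [sqrt (8 ln 2)] within [5 / 10^5] of [2.3548]. *)
Lemma ln2_lb : 693 / 10 ^+ 3 + 106 / 10 ^+ 6 <= ln 2 :> R.
Proof.
rewrite -ler_expR lnK ?posrE//.
have h : 0 <= (693 / 10 ^+ 3 + 106 / 10 ^+ 6 : R) <= 1 by lra.
apply: le_trans (expR_le_partial_sum (m := 7) h isT) _.
rewrite series_exp_coeff7 /exp_coeff/= !factS fact0 !natrM.
lra.
Qed.

Lemma ln2_ub : ln 2 <= 693 / 10 ^+ 3 + 164 / 10 ^+ 6 :> R.
Proof.
rewrite -ler_expR lnK ?posrE//.
have h : 0 <= 693 / 10 ^+ 3 + 164 / 10 ^+ 6 :> R by lra.
apply: le_trans _ (expR_ge_partial_sum 7 h).
rewrite series_exp_coeff7; lra.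
Qed.

Lemma sqrt_8ln2_approx :
  `|Num.sqrt (8 * ln 2) - (2 + 3548 / 10 ^+ 4)| < 5 / 10 ^+ 5 :> R.
Proof.
have lb := ln2_lb; have ub := ln2_ub.
have y0 : 0 <= Num.sqrt (8 * ln 2) :> R by exact: sqrtr_ge0.
have y2 : Num.sqrt (8 * ln 2) ^+ 2 = 8 * ln 2 :> R by rewrite sqr_sqrtr//; lra.
move: (Num.sqrt _) y0 y2 => y y0 y2.
have bnd (t : R) : 0 <= t -> (t ^+ 2 < 8 * ln 2 -> t < y) /\ (8 * ln 2 < t ^+ 2 -> y < t).
  by move=> t0; rewrite -y2; split; rewrite ltr_pXn2r// nnegrE.
rewrite ltr_distl; apply/andP; split; apply bnd; lra.
Qed.

End ln2_bounds.

(** * The diameter *)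

Section nonmeasurable_bound.
Local Open Scope ereal_scope.

Lemma limn_einf_le {R : realType} (u v : (\bar R)^nat) :
  (forall n, u n <= v n) -> limn_einf u <= limn_einf v.
Proof.
move=> uv; rewrite !limn_einf_lim; apply: lee_lim; [exact: is_cvg_einfs..|].
apply: nearW => n; apply: le_ereal_inf_tmp => _ [m /= nm <-].
by apply: le_trans (uv m); apply: ereal_inf_lbound; exists m.
Qed.

Lemma cvg_limn_einfE {R : realType} (u : (\bar R)^nat) (l : \bar R) :
  u @ \oo --> l -> limn_einf u = l.
Proof.
move=> ul; rewrite is_cvg_limn_einfE; first exact/cvg_lim.
by apply/cvg_ex; exists l.
Qed.

Import HBNNSimple.

(** This serves for the diameter, whose measurability is not established. The integral of [f] is a
    supremum over simple functions [h] below [f], and each [h] is measurable and almost everywhere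
    below [g]. *)
Lemma ge0_le_integral_ae d (T : measurableType d) {R : realType}
    (mu : {measure set T -> \bar R}) (f g : T -> \bar R) :
  (forall w, 0 <= f w) -> (forall w, 0 <= g w) -> measurable_fun [set: T] g ->
  {ae mu, forall w, f w <= g w} -> \int[mu]_w f w <= \int[mu]_w g w.
Proof.
move=> f0 g0 mg [N [mN N0 fgN]].
rewrite ge0_integralTE//; apply: ge_ereal_sup => _ [h hf <-].
rewrite -integralT_nnsfun; apply: ae_ge0_le_integral => //.
- by move=> w _; rewrite lee_fin.
- by apply/measurable_EFinP; exact: measurable_funPT.
exists N; split => // w /= hg; apply: fgN => /= fg; apply: hg => _.
exact: le_trans (hf w) fg.
Qed.

End nonmeasurable_bound.

(** The last grid point not exceeding [s] tends to [s] without leaving [[0, 1]], so continuity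
    relative to [[0, 1]] is enough. *)
Lemma cvg_grid {R : realType} (f : R -> R) (s : R) : 0 <= s <= 1 ->
  {within `[0, 1]%classic, continuous f} ->
  (fun n : nat => f ((Num.truncn (s * n.+1%:R))%:R / n.+1%:R)) @ \oo --> f s.
Proof.
move=> /andP[s0 s1] /subspace_continuousP/(_ s) cf.
have /cf {}cf : `[0, 1]%classic s by rewrite /= in_itv/= s0 s1.
pose sn (n : nat) : R := (Num.truncn (s * n.+1%:R))%:R / n.+1%:R.
have n0 (n : nat) : 0 < n.+1%:R :> R by rewrite ltr0n.
have snle n : sn n <= s.
  by rewrite ler_pdivrMr// truncn_le mulr_ge0.
have lesn n : s - n.+1%:R^-1 <= sn n.
  rewrite lerBlDr -[X in _ + X]mul1r -mulrDl natr1 ler_pdivlMr// ltW//.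
  by have /andP[] := truncn_itv (mulr_ge0 s0 (ltW (n0 n))).
have sns : sn @ \oo --> s.
  apply: (@squeeze_cvgr _ _ _ _ (fun n : nat => s - n.+1%:R^-1) (cst s)).
  - by apply: nearW => n; rewrite lesn snle.
  - by rewrite -[X in _ --> X]subr0; apply: cvgB; [exact: cvg_cst|exact: cvg_harmonic].
  - exact: cvg_cst.
apply: (cvg_comp sn f _ cf) => A hA.
have {hA} : \forall n \near \oo, `[0, 1]%classic (sn n) -> A (sn n) := sns _ hA.
apply: filterS => n; apply.
by rewrite /= in_itv/= (le_trans (snle n) s1) andbT divr_ge0.
Qed.

(** * From grid ranges to the diameter *)

Section diameter.
Context d (T : measurableType d) {R : realType} (P : probability T R).

Definition grid_range (X : R -> T -> R) (n : nat) (w : T) : R :=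
  let S i := X (i%:R / n.+1%:R) w - X 0 w in
  running_max S n.+1 - running_min S n.+1.

Lemma le_grid_range (X : R -> T -> R) n w i j : (i <= n.+1)%N -> (j <= n.+1)%N ->
  (X (i%:R / n.+1%:R) w - X (j%:R / n.+1%:R) w) ^+ 2 <= grid_range X n w ^+ 2.
Proof.
move=> ni nj; set S := fun i : nat => X (i%:R / n.+1%:R) w - X 0 w.
have hM (k : nat) : (k <= n.+1)%N -> S k <= running_max S n.+1 := @le_running_max _ S _ k.
have hm (k : nat) : (k <= n.+1)%N -> running_min S n.+1 <= S k := @ge_running_min _ S _ k.
have := hM i ni; have := hM j nj; have := hm i ni; have := hm j nj.
rewrite /grid_range -/S -[X _ w - _](_ : S i - S j = _); last by rewrite /S; ring.
move: (S i) (S j) (running_max _ _) (running_min _ _) => x y a c h1 h2 h3 h4.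
have : 0 <= a - c - (x - y) by lra.
have : 0 <= a - c + (x - y) by lra.
by move=> p q; have := mulr_ge0 p q; rewrite -[_ <= (a - c) ^+ 2]subr_ge0 subr_sqr mulrC.
Qed.

Variable b : R -> T -> R * R.
Hypothesis bbm : planar_brownian_motion P b.
Let X t w := (b t w).1.
Let Y t w := (b t w).2.

Lemma grid_range_second_moment (Z : R -> T -> R) n : brownian_motion P Z ->
  measurable_fun [set: T] (grid_range Z n) /\
  (\int[P]_w (grid_range Z n w ^+ 2)%:E <= (4 * ln 2)%:E)%E.
Proof.
move=> Zbm; pose u (i : nat) : R := i%:R / n.+1%:R.
have u0 : u 0%N = 0 by rewrite /u mul0r.
have und i : u i <= u i.+1 by rewrite ler_pM2r ?invr_gt0 ?ltr0n// ler_nat.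
have un : u n.+1 = 1 by rewrite /u divff.
split; first exact: (measurable_grid_range Zbm u0 und un).
exact: (integral_sqr_range_le Zbm u0 und un).
Qed.

Lemma integral_diameter_le : (\int[P]_w euclidean_diameter (trace01 b w)
     <= (Num.sqrt (8 * ln 2))%:E)%E.
Proof.
have [Xbm Ybm _] := bbm.
set s := Num.sqrt (8 * ln 2).
have ln20 : 0 < ln 2 :> R by rewrite ln_gt0// ltr1n.
have s0 : 0 < s by rewrite sqrtr_gt0 mulr_gt0.
have s2 : s ^+ 2 = 8 * ln 2 by rewrite sqr_sqrtr// mulr_ge0// ltW.
pose D n w := (grid_range X n w ^+ 2 + grid_range Y n w ^+ 2)%:E.
have D0 n w : (0 <= D n w)%E by rewrite lee_fin addr_ge0 ?sqr_ge0.
have mX n : measurable_fun [set: T] (fun w => (grid_range X n w ^+ 2)%:E).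
  by apply/measurable_EFinP/measurable_funX; exact: (grid_range_second_moment n Xbm).1.
have mY n : measurable_fun [set: T] (fun w => (grid_range Y n w ^+ 2)%:E).
  by apply/measurable_EFinP/measurable_funX; exact: (grid_range_second_moment n Ybm).1.
have mD n : measurable_fun [set: T] (D n) by exact: emeasurable_funD (mX n) (mY n).
have DE n : (\int[P]_w D n w <= (s ^+ 2)%:E)%E.
  rewrite /D; under eq_integral do rewrite EFinD.
  rewrite ge0_integralD//.
  - rewrite s2 (_ : 8 * ln 2 = 4 * ln 2 + 4 * ln 2); last by ring.
    rewrite EFinD; apply: leeD; first exact: (grid_range_second_moment n Xbm).2.
    exact: (grid_range_second_moment n Ybm).2.
  - by move=> w _; rewrite lee_fin sqr_ge0.
  - by move=> w _; rewrite lee_fin sqr_ge0.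
(* Fatou keeps the bound [s^2] for this lower limit, which will dominate the squared distances on a
   continuous path. *)
pose L w := limn_einf (D ^~ w).
have LE : (\int[P]_w L w <= (s ^+ 2)%:E)%E.
  apply: (le_trans (@fatou _ _ _ P _ measurableT D mD (fun n w _ => D0 n w))).
  apply: (le_trans (limn_einf_le DE)).
  by rewrite (cvg_limn_einfE (cvg_cst (s ^+ 2)%:E)).
have L0 w : (0 <= L w)%E.
  have -> : 0%E = limn_einf (cst 0%E : (\bar R)^nat).
    by rewrite (cvg_limn_einfE (cvg_cst 0%E)).
  by apply: limn_einf_le => n; exact: D0.
have mL : measurable_fun [set: T] L.
  rewrite /L /limn_einf; apply: measurableT_comp => //.
  apply: (@measurable_fun_limn_esup _ _ _ _ (fun n w => - D n w)%E) => n.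
  exact: measurableT_comp.
(* This is [d^2 / (2 s) + s / 2] with [L] in place of [d^2]. It is affine in [L], so its integral is
   at most [s^2 / (2 s) + s / 2 = s]. *)
pose g w := ((2 * s)^-1%:E * L w + (s / 2)%:E)%E.
have k0 : 0 <= (2 * s)^-1 by rewrite invr_ge0 mulr_ge0// ltW.
have g0 w : (0 <= g w)%E by rewrite adde_ge0 ?mule_ge0 ?lee_fin// divr_ge0// ltW.
have mg : measurable_fun [set: T] g.
  by apply: emeasurable_funD => //; exact: measurable_funeM.
apply: (@le_trans _ _ (\int[P]_w g w)%E); last first.
  rewrite /g ge0_integralD//; last 3 first.
  - by move=> w _; rewrite mule_ge0.
  - exact: measurable_funeM.
  - by move=> w _; rewrite lee_fin divr_ge0// ltW.
  rewrite ge0_integralZl// integral_cst// [X in (_ + _ * X)%E](probability_setT P) mule1.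
  apply: (@le_trans _ _ ((2 * s)^-1%:E * (s ^+ 2)%:E + (s / 2)%:E)%E).
    by rewrite leeD2r// lee_wpmul2l// lee_fin.
  by rewrite -EFinM -EFinD lee_fin le_eqVlt; apply/orP; left; apply/eqP; field; rewrite gt_eqF.
have diamE w : (forall t1 t2, 0 <= t1 <= 1 -> 0 <= t2 <= 1 ->
    (((X t1 w - X t2 w) ^+ 2 + (Y t1 w - Y t2 w) ^+ 2)%:E <= L w)%E) ->
    (euclidean_diameter (trace01 b w) <= g w)%E.
  move=> h; apply: ge_ereal_sup => _ [_ [t1 /= t1I <-]] [_ [t2 /= t2I <-]] <-.
  move: t1I t2I; rewrite !in_itv /= => t1I t2I.
  have := h _ _ t1I t2I; rewrite /euclidean_norm/=.
  set e2 := (_ + _) => eL.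
  have e20 : 0 <= e2 by rewrite addr_ge0 ?sqr_ge0.
  apply: (@le_trans _ _ ((2 * s)^-1 * e2 + s / 2)%:E).
    rewrite lee_fin -[in leRHS](sqr_sqrtr e20).
    set e := Num.sqrt e2.
    have : 0 <= (2 * s)^-1 * (e - s) ^+ 2 by rewrite mulr_ge0 ?sqr_ge0.
    rewrite (_ : _ * _ = (2 * s)^-1 * e ^+ 2 + s / 2 - e) ?subr_ge0//.
    by field; rewrite gt_eqF.
  by rewrite EFinD EFinM leeD2r// lee_wpmul2l.
apply: ge0_le_integral_ae => //.
  (* The trace contains [b 0 w], at distance 0 from itself; over an empty set the supremum would be
     [-oo]. *)
  move=> w; apply: ereal_sup_ubound; exists (b 0 w); first by exists 0 => //=; rewrite in_itv/= lexx ler01.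
  exists (b 0 w); first by exists 0 => //=; rewrite in_itv/= lexx ler01.
  by rewrite subrr /euclidean_norm /= expr0n addr0 sqrtr0.
move: (bm_continuous Xbm) (bm_continuous Ybm); apply: filterS2 => w cX cY.
apply: diamE => t1 t2 t1I t2I.
pose tn (t : R) (n : nat) : R := (Num.truncn (t * n.+1%:R))%:R / n.+1%:R.
pose v (n : nat) := ((X (tn t1 n) w - X (tn t2 n) w) ^+ 2 + (Y (tn t1 n) w - Y (tn t2 n) w) ^+ 2).
have tni (t : R) (n : nat) : 0 <= t <= 1 -> (Num.truncn (t * n.+1%:R) <= n.+1)%N.
  move=> /andP[t0 t1']; rewrite -(ler_nat R).
  apply: (@le_trans _ _ (t * n.+1%:R)); first by rewrite truncn_le mulr_ge0.
  by rewrite ler_piMl.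
have cv : v @ \oo --> (X t1 w - X t2 w) ^+ 2 + (Y t1 w - Y t2 w) ^+ 2.
  have c2 (Z : R -> T -> R) : {within `[0, 1]%classic, continuous (fun t => Z t w)} ->
      (fun n : nat => (Z (tn t1 n) w - Z (tn t2 n) w) ^+ 2) @ \oo --> (Z t1 w - Z t2 w) ^+ 2.
    move=> cZ; have dZ : (fun n : nat => Z (tn t1 n) w - Z (tn t2 n) w) @ \oo --> Z t1 w - Z t2 w.
      by apply: cvgB; [exact: (cvg_grid t1I cZ)|exact: (cvg_grid t2I cZ)].
    exact: (cvgM dZ dZ).
  by apply: cvgD; [exact: c2 cX|exact: c2 cY].
(* The squared distance is the limit of its values [v n] at nearby grid times, and [D n w] dominates
   each of these. *)
have -> : ((X t1 w - X t2 w) ^+ 2 + (Y t1 w - Y t2 w) ^+ 2)%:E = limn_einf (EFin \o v).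
  have cE : (EFin \o v) @ \oo --> ((X t1 w - X t2 w) ^+ 2 + (Y t1 w - Y t2 w) ^+ 2)%:E.
    by apply: cvg_EFin; [exact: nearW|exact: cv].
  by rewrite (cvg_limn_einfE cE).
apply: limn_einf_le => n; rewrite /D lee_fin.
by apply: lerD; apply: le_grid_range; exact: tni.
Qed.

End diameter.

Theorem proposition5 (R : realType) (d : measure_display)
    (T : measurableType d) (P : probability T R) (b : R -> T -> R * R)
    (b_bm : planar_brownian_motion P b) :
  (\int[P]_w euclidean_diameter (trace01 b w)
     <= (Num.sqrt (8 * ln 2))%:E)%E /\
  `|Num.sqrt (8 * ln 2) - (2 + 3548 / 10 ^+ 4)| < 5 / 10 ^+ 5 :> R.
Proof.
by split; [exact: integral_diameter_le|exact: sqrt_8ln2_approx].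
Qed.
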